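(* Heyting's arithmetic HA can be interpreted in the theory INF plus the Church counting axiom $\forall j\in\mathbb{N}\,(j\,\mathsf{S}\,\mathbf{0}=j)$.
   Context: HA is first-order intuitionistic arithmetic with $0$, successor, addition, multiplication and the full induction schema. ''Interpreted'' is meant in the usual sense of a relative interpretation: formulas of HA are translated to formulas of set theory with quantifiers relativized to a definable domain and the symbols of HA replaced by defined notions, so that translations of theorems of HA are provable in the interpreting theory. INF (intuitionistic New Foundations) is the first-order theory with equality over intuitionistic logic, with one binary predicate $\in$, whose axioms are extensionality ($\forall z(z\in x\leftrightarrow z\in y)\to x=y$) and stratified comprehension (the set $\{x:\varphi\}$ exists for every stratified $\varphi$, parameters allowed; $\varphi$ is stratified if its variables can be assigned natural-number indices so that in each subformula $x\in y$ the index of $y$ is one more than that of $x$, and in each $x=y$ the indices agree). Ordered pairs are $\langle x,y\rangle=\{\{x\},\{x,y\}\}$. $\mathrm{FUNC}=\{f:\forall x,y,z(\langle x,y\rangle\in f\to\langle x,z\rangle\in f\to y=z)\}$. Application: $Ap(f,x)=\{t:\exists y(\langle x,y\rangle\in f\land t\in y)\}$, so $Ap(f,x)=y$ if $f\in\mathrm{FUNC}$ and $\langle x,y\rangle\in f$. Write $fx$ for $Ap(f,x)$, associating to the left; so $j\,\mathsf{S}\,\mathbf{0}$ means $Ap(Ap(j,\mathsf{S}),\mathbf{0})$. Church numbers: $\mathbf{0}=\{\langle f,\mathrm{id}\rangle: f=f\}$ with $\mathrm{id}=\{\langle x,x\rangle:x=x\}$. Church successor is the set of all pairs $\langle z,s_z\rangle$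 with $z\in\mathrm{FUNC}$, where $s_z$ is the set of all $\langle f,p\rangle$ with $f\in\mathrm{FUNC}$ and $\forall u\,(u\in p\leftrightarrow\exists x,w,t,q\,(u=\langle x,w\rangle\land t\in\mathrm{FUNC}\land\langle f,t\rangle\in z\land\langle x,q\rangle\in t\land\langle q,w\rangle\in f))$; it is denoted $\mathsf{S}$. $\mathbb{N}$ is the intersection of all sets containing $\mathbf{0}$ and closed under $\mathsf{S}$. *)

(* Defs.v *)
From Stdlib Require Import List Arith.
Import ListNotations.

Set Implicit Arguments.
Unset Strict Implicit.
Unset Printing Implicit Defensive.

(** * Intuitionistic first-order logic with equality

    Variables are de Bruijn indices.  Besides equality, only binary relation
    symbols are provided: the language of arithmetic has none and the language
    of set theory has one. *)

Record language := Language {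
  term : Type;
  rel : Type;
  var : nat -> term;
  tsubst : (nat -> term) -> term -> term;
  tscoped : nat -> term -> Prop   (* all variables of the term are [< n] *)
}.

Inductive form (L : language) : Type :=
| Bot
| Eq (s t : term L)
| Rel (r : rel L) (s t : term L)
| And (p q : form L)
| Or (p q : form L)
| Imp (p q : form L)
| All (p : form L)
| Ex (p : form L).

Arguments Bot {L}.
Arguments Eq {L} s t.
Arguments Rel {L} r s t.

Definition Iff L (p q : form L) : form L := And (Imp p q) (Imp q p).

Section Syntax.
Variable L : language.

Definition up (s : nat -> term L) (n : nat) : term L :=
  match n with
  | 0 => var L 0
  | S m => tsubst (fun k => var L (S k)) (s m)
  end.

Fixpoint subst (s : nat -> term L) (p : form L) : form L :=
  match p with
  | Bot => Bot
  | Eq t u => Eq (tsubst s t) (tsubst s u)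
  | Rel r t u => Rel r (tsubst s t) (tsubst s u)
  | And p q => And (subst s p) (subst s q)
  | Or p q => Or (subst s p) (subst s q)
  | Imp p q => Imp (subst s p) (subst s q)
  | All p => All (subst (up s) p)
  | Ex p => Ex (subst (up s) p)
  end.

Definition shift (p : form L) : form L := subst (fun n => var L (S n)) p.

Definition inst (t : term L) (p : form L) : form L :=
  subst (fun n => match n with 0 => t | S m => var L m end) p.

Fixpoint scoped (n : nat) (p : form L) : Prop :=
  match p with
  | Bot => True
  | Eq t u | Rel _ t u => tscoped n t /\ tscoped n u
  | And p q | Or p q | Imp p q => scoped n p /\ scoped n q
  | All p | Ex p => scoped (S n) p
  end.

Definition sentence (p : form L) : Prop := scoped 0 p.

Definition theory := form L -> Prop.

(** Axioms are not affected by the shift in [AllI] and [ExE], so an axiom with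
    free variables counts as its universal closure. *)

Inductive derives (T : theory) : list (form L) -> form L -> Prop :=
| Ax G p : T p -> derives T G p
| Hyp G p : In p G -> derives T G p
| BotE G p : derives T G Bot -> derives T G p
| AndI G p q : derives T G p -> derives T G q -> derives T G (And p q)
| AndE1 G p q : derives T G (And p q) -> derives T G p
| AndE2 G p q : derives T G (And p q) -> derives T G q
| OrI1 G p q : derives T G p -> derives T G (Or p q)
| OrI2 G p q : derives T G q -> derives T G (Or p q)
| OrE G p q r : derives T G (Or p q) ->
    derives T (p :: G) r -> derives T (q :: G) r -> derives T G r
| ImpI G p q : derives T (p :: G) q -> derives T G (Imp p q)
| ImpE G p q : derives T G (Imp p q) -> derives T G p -> derives T G q
| AllI G p : derives T (map shift G) p -> derives T G (All p)
| AllE G p t : derives T G (All p) -> derives T G (inst t p)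
| ExI G p t : derives T G (inst t p) -> derives T G (Ex p)
| ExE G p q : derives T G (Ex p) ->
    derives T (p :: map shift G) (shift q) -> derives T G q
| EqI G t : derives T G (Eq t t)
| EqE G p s t : derives T G (Eq s t) ->
    derives T G (inst s p) -> derives T G (inst t p).

Definition provable (T : theory) (p : form L) : Prop := derives T [] p.

Definition extend (T : theory) (p : form L) : theory := fun q => T q \/ q = p.

End Syntax.

(** * Heyting arithmetic *)

Inductive ha_term : Type :=
| HVar (n : nat)
| HZero
| HSucc (t : ha_term)
| HAdd (t u : ha_term)
| HMul (t u : ha_term).

Fixpoint ha_subst (s : nat -> ha_term) (t : ha_term) : ha_term :=
  match t with
  | HVar n => s n
  | HZero => HZero
  | HSucc t => HSucc (ha_subst s t)
  | HAdd t u => HAdd (ha_subst s t) (ha_subst s u)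
  | HMul t u => HMul (ha_subst s t) (ha_subst s u)
  end.

Fixpoint ha_scoped (n : nat) (t : ha_term) : Prop :=
  match t with
  | HVar m => m < n
  | HZero => True
  | HSucc t => ha_scoped n t
  | HAdd t u | HMul t u => ha_scoped n t /\ ha_scoped n u
  end.

Definition ha_lang : language :=
  {| term := ha_term; rel := Empty_set; var := HVar;
     tsubst := ha_subst; tscoped := ha_scoped |}.

Definition ha_eq (t u : ha_term) : form ha_lang := @Eq ha_lang t u.

Inductive HA : theory ha_lang :=
| HA_succ_neq_zero :
    HA (Imp (ha_eq (HSucc (HVar 0)) HZero) Bot)
| HA_succ_inj :
    HA (Imp (ha_eq (HSucc (HVar 0)) (HSucc (HVar 1)))
            (ha_eq (HVar 0) (HVar 1)))
| HA_add_zero :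
    HA (ha_eq (HAdd (HVar 0) HZero) (HVar 0))
| HA_add_succ :
    HA (ha_eq (HAdd (HVar 0) (HSucc (HVar 1)))
              (HSucc (HAdd (HVar 0) (HVar 1))))
| HA_mul_zero :
    HA (ha_eq (HMul (HVar 0) HZero) HZero)
| HA_mul_succ :
    HA (ha_eq (HMul (HVar 0) (HSucc (HVar 1)))
              (HAdd (HMul (HVar 0) (HVar 1)) (HVar 0)))
(* In [p] the induction variable is [0] and the parameters are [1, 2, ...]. *)
| HA_induction (p : form ha_lang) :
    HA (Imp (@inst ha_lang HZero p)
       (Imp (All (Imp p (@subst ha_lang
                    (fun n => match n with
                              | 0 => HSucc (HVar 0)
                              | S m => HVar (S m)
                              end) p)))
            (All p))).

(** * Intuitionistic New Foundations *)

(** The only terms of set theory are variables, and [tt] stands for the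
    membership symbol. *)

Definition set_lang : language :=
  {| term := nat; rel := unit; var := fun n => n;
     tsubst := fun s x => s x; tscoped := fun n x => x < n |}.

Definition sform : Type := form set_lang.

Definition set_eq (x y : nat) : sform := @Eq set_lang x y.
Definition set_mem (x y : nat) : sform := @Rel set_lang tt x y.

(** [e] assigns types to the free variables; every quantifier chooses a type
    for the variable it binds. *)

Fixpoint stratified_by (e : nat -> nat) (p : sform) : Prop :=
  match p with
  | Bot => True
  | Eq x y => e x = e y
  | Rel _ x y => e y = S (e x)
  | And p q | Or p q | Imp p q => stratified_by e p /\ stratified_by e q
  | All p | Ex p =>
      exists k, stratified_by (fun n => match n with 0 => k | S m => e m end) p
  end.

Definition stratified (p : sform) : Prop := exists e, stratified_by e p.

Inductive INF : theory set_lang :=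
| INF_extensionality :
    INF (Imp (All (Iff (set_mem 0 1) (set_mem 0 2))) (set_eq 0 1))
(* [exists y, forall x, x \in y <-> p]: in [p] the element [x] is [0] and the
   parameters are [1, 2, ...], which are renamed to make room for [y]. *)
| INF_comprehension (p : sform) :
    stratified p ->
    INF (Ex (All (Iff (set_mem 0 1)
      (@subst set_lang
         (fun n => match n with 0 => 0 | S m => S (S m) end) p)))).

(** * The Church counting axiom *)

(** Formulas with named bound variables.  A bound variable is identified with
    the number [x] of quantifiers enclosing its binder; under [d] quantifiers it
    is the de Bruijn index [d - S x].  An [hform] maps the depth [d] to the
    formula. *)

Definition hform : Type := nat -> sform.

Definition h_mem (x y : nat) : hform := fun d => set_mem (d - S x) (d - S y).
Definition h_eq (x y : nat) : hform := fun d => set_eq (d - S x) (d - S y).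
Definition h_and (p q : hform) : hform := fun d => And (p d) (q d).
Definition h_or (p q : hform) : hform := fun d => Or (p d) (q d).
Definition h_imp (p q : hform) : hform := fun d => Imp (p d) (q d).
Definition h_iff (p q : hform) : hform := fun d => Iff (p d) (q d).
Definition h_all (p : nat -> hform) : hform := fun d => All (p d (S d)).
Definition h_ex (p : nat -> hform) : hform := fun d => Ex (p d (S d)).

Declare Scope hform_scope.
Delimit Scope hform_scope with hf.
Bind Scope hform_scope with hform.

Local Notation "x 'in_' y" := (h_mem x y) (at level 70) : hform_scope.
Local Notation "x == y" := (h_eq x y) (at level 70) : hform_scope.
Local Notation "p /\ q" := (h_and p q) : hform_scope.
Local Notation "p \/ q" := (h_or p q) : hform_scope.
Local Notation "p -> q" := (h_imp p q) : hform_scope.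
Local Notation "p <-> q" := (h_iff p q) : hform_scope.
Local Notation "'all' x .. y , p" :=
  (h_all (fun x => .. (h_all (fun y => p%hf)) ..))
  (at level 200, x binder, y binder, right associativity) : hform_scope.
Local Notation "'ex' x .. y , p" :=
  (h_ex (fun x => .. (h_ex (fun y => p%hf)) ..))
  (at level 200, x binder, y binder, right associativity) : hform_scope.

(** The defined set terms are eliminated: [is_c a y] expresses [y = c(a)]. *)

Definition is_singleton (x y : nat) : hform :=
  (all z, z in_ y <-> z == x)%hf.

Definition is_unordered_pair (x1 x2 y : nat) : hform :=
  (all z, z in_ y <-> z == x1 \/ z == x2)%hf.

Definition is_pair (x1 x2 y : nat) : hform :=
  (all z, z in_ y <-> is_singleton x1 z \/ is_unordered_pair x1 x2 z)%hf.

Definition pair_in (x y f : nat) : hform :=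
  (ex u, is_pair x y u /\ u in_ f)%hf.

Definition in_FUNC (f : nat) : hform :=
  (all x y z, pair_in x y f -> pair_in x z f -> y == z)%hf.

Definition is_Ap (f x v : nat) : hform :=
  (all t, t in_ v <-> ex y, pair_in x y f /\ t in_ y)%hf.

Definition is_id (i : nat) : hform :=
  (all u, u in_ i <-> ex x, x == x /\ is_pair x x u)%hf.

Definition is_church_zero (o : nat) : hform :=
  (all u, u in_ o <-> ex f i, f == f /\ is_id i /\ is_pair f i u)%hf.

Definition is_church_succ_value (z s : nat) : hform :=
  (all v, v in_ s <-> ex f p, is_pair f p v /\ in_FUNC f /\
     all u, u in_ p <-> ex x w t q,
       is_pair x w u /\ in_FUNC t /\ pair_in f t z /\
       pair_in x q t /\ pair_in q w f)%hf.

Definition is_church_succ (s : nat) : hform :=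
  (all v, v in_ s <-> ex z sz,
     is_pair z sz v /\ in_FUNC z /\ is_church_succ_value z sz)%hf.

Definition contains_zero (a : nat) : hform :=
  (ex o, is_church_zero o /\ o in_ a)%hf.

Definition closed_under_succ (a : nat) : hform :=
  (all x, x in_ a -> ex s y, is_church_succ s /\ is_Ap s x y /\ y in_ a)%hf.

Definition in_N (j : nat) : hform :=
  (all a, contains_zero a -> closed_under_succ a -> j in_ a)%hf.

Definition church_counting : sform :=
  (all j, in_N j -> ex s o js,
     is_church_succ s /\ is_church_zero o /\
     is_Ap j s js /\ is_Ap js o j)%hf 0.

(** * Relative interpretations of arithmetic in set theory *)

(** Function symbols are interpreted by formulas defining their graphs, the
    arguments being the variables [0, 1, ...] in order and the value the last
    variable.  Equality is interpreted by equality. *)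

Record interpretation := Interpretation {
  dom : sform;
  zero_graph : sform;
  succ_graph : sform;
  add_graph : sform;
  mul_graph : sform
}.

Definition at_vars (p : sform) (xs : list nat) : sform :=
  @subst set_lang (fun n => nth n xs 0) p.

Section Translation.
Variable I : interpretation.

(** [denotes e t y] says that the value of [t] is [y] when the variable [n] of
    arithmetic is read as the set variable [e n]. *)

Fixpoint denotes (e : nat -> nat) (t : ha_term) (y : nat) : sform :=
  match t with
  | HVar n => set_eq (e n) y
  | HZero => at_vars (zero_graph I) [y]
  | HSucc t =>
      Ex (And (at_vars (dom I) [0])
         (And (denotes (fun n => 1 + e n) t 0)
              (at_vars (succ_graph I) [0; 1 + y])))
  | HAdd t u =>
      Ex (And (at_vars (dom I) [0]) (Ex (And (at_vars (dom I) [0])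
         (And (denotes (fun n => 2 + e n) t 1)
         (And (denotes (fun n => 2 + e n) u 0)
              (at_vars (add_graph I) [1; 0; 2 + y]))))))
  | HMul t u =>
      Ex (And (at_vars (dom I) [0]) (Ex (And (at_vars (dom I) [0])
         (And (denotes (fun n => 2 + e n) t 1)
         (And (denotes (fun n => 2 + e n) u 0)
              (at_vars (mul_graph I) [1; 0; 2 + y]))))))
  end.

Fixpoint translate (p : form ha_lang) : sform :=
  match p with
  | Bot => Bot
  | Eq t u =>
      Ex (And (at_vars (dom I) [0])
         (And (denotes (fun n => 1 + n) t 0) (denotes (fun n => 1 + n) u 0)))
  | Rel r _ _ => match r : Empty_set with end
  | And p q => And (translate p) (translate q)
  | Or p q => Or (translate p) (translate q)
  | Imp p q => Imp (translate p) (translate q)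
  | All p => All (Imp (at_vars (dom I) [0]) (translate p))
  | Ex p => Ex (And (at_vars (dom I) [0]) (translate p))
  end.

(** There is exactly one [y] in the domain with [g(xs, y)]. *)

Definition unique_value (g : sform) (xs : list nat) : sform :=
  Ex (And (And (at_vars (dom I) [0]) (at_vars g (map (Nat.add 1) xs ++ [0])))
    (All (Imp (at_vars (dom I) [0])
         (Imp (at_vars g (map (Nat.add 2) xs ++ [0])) (set_eq 0 1))))).

Definition all_dom (p : sform) : sform := All (Imp (at_vars (dom I) [0]) p).

Record interprets (A : theory ha_lang) (T : theory set_lang) : Prop :=
  Interprets {
    dom_scoped : scoped 1 (dom I);
    zero_scoped : scoped 1 (zero_graph I);
    succ_scoped : scoped 2 (succ_graph I);
    add_scoped : scoped 3 (add_graph I);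
    mul_scoped : scoped 3 (mul_graph I);
    dom_inhabited : provable T (Ex (at_vars (dom I) [0]));
    zero_defined : provable T (unique_value (zero_graph I) []);
    succ_defined : provable T (all_dom (unique_value (succ_graph I) [0]));
    add_defined :
      provable T (all_dom (all_dom (unique_value (add_graph I) [1; 0])));
    mul_defined :
      provable T (all_dom (all_dom (unique_value (mul_graph I) [1; 0])));
    theorems_translated :
      forall p, sentence p -> provable A p -> provable T (translate p)
  }.

End Translation.

Definition interpretable_in (A : theory ha_lang) (T : theory set_lang) : Prop :=
  exists I : interpretation, interprets I A T.

(* Main.v *)
From Stdlib Require Import List Arith Lia.
Require Import Defs.
Import ListNotations.

(** Arithmetic is read on [N] with the Church successor.  A Church number is
    never [0] and a successor at once because [0] is also defined on non-functions.
    Injectivity uses counting: if [g] extends [S] by [a |-> 0], where [a] is not a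
    function, then [(n + 1) g a = n S 0], which counting says is [n]; so [n] can be
    read off its successor.  Sums and products are least relations closed under
    the recursion equations; for a fixed first argument, the second argument and
    the value have the same type.  Hence the translation of every formula is
    stratified with all variables of one type, and gets its induction axiom.

    Derivations in set theory are handled through forcing: a proposition is a
    predicate on contexts, and forcing a formula is the same as deriving it. *)

Set Implicit Arguments.
Unset Strict Implicit.

(** * Renaming and fresh variables in derivations *)

(** In [n S 0] the number [n] lies six types above the result: each of the two applications costs
    two types for a Kuratowski pair and one for membership. For the same reason [n S m] does not
    give an addition whose variables all have one type.

    The detour through [g] is needed because [(n + 1) S 0] is by counting just [n + 1], which says
    nothing about [n]. With an extra point [a] placed before [0], [n + 1] steps from [a] end where
    [n] steps from [0] end. This point must lie outside the domain of [S], so that [g] stays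
    single-valued, and off the orbit of [0]; a non-function does both, since [S] acts on functions
    only and Church numbers are functions.

    The forcing clauses range over all larger contexts and all variable names, so weakening and
    freshness are settled once, and set theory is then argued in the logic of Rocq. *)

Notation ctx := (list sform).

Definition scons (x : nat) (e : nat -> nat) (n : nat) : nat :=
  match n with 0 => x | S m => e m end.

Notation "x .: e" := (scons x e) (at level 55, right associativity).

Notation rename := (@subst set_lang).

Lemma up_ext (s s' : nat -> nat) :
  (forall n, s n = s' n) -> forall n, @up set_lang s n = @up set_lang s' n.
Proof. intros H [|n]; cbn; congruence. Qed.

Lemma rename_ext (p : sform) : forall s s', (forall n, s n = s' n) ->
  rename s p = rename s' p.
Proof.
  induction p; cbn; intros s' s'' H; f_equal; auto using up_ext.
Qed.

Lemma rename_comp (p : sform) : forall s s',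
  rename s (rename s' p) = rename (fun n => s (s' n)) p.
Proof.
  induction p; cbn; intros s' s''; f_equal; auto.
  - rewrite IHp. apply rename_ext. now intros [|n].
  - rewrite IHp. apply rename_ext. now intros [|n].
Qed.

Lemma rename_id (p : sform) : forall s, (forall n, s n = n) -> rename s p = p.
Proof.
  induction p; cbn; intros s' H; f_equal; auto.
  - apply IHp. intros [|n]; cbn; auto.
  - apply IHp. intros [|n]; cbn; auto.
Qed.

Lemma rename_scoped (p : sform) : forall n s s', scoped n p ->
  (forall m, m < n -> s m = s' m) -> rename s p = rename s' p.
Proof.
  induction p; cbn; intros n s' s'' Hn H; f_equal; try (now intuition eauto).
  - apply (IHp (S n)); auto. intros [|m]; cbn; auto. intros; f_equal; apply H; lia.
  - apply (IHp (S n)); auto. intros [|m]; cbn; auto. intros; f_equal; apply H; lia.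
Qed.

Lemma scoped_le (p : sform) : forall n m, n <= m -> scoped n p -> scoped m p.
Proof.
  induction p; cbn; intros n m H Hn; intuition eauto; try lia.
  - apply (IHp (S n)); auto; lia.
  - apply (IHp (S n)); auto; lia.
Qed.

Lemma scoped_bound (p : sform) : exists n, scoped n p.
Proof.
  assert (two : forall q r : sform, (exists n, scoped n q) ->
    (exists n, scoped n r) -> exists n, scoped n q /\ scoped n r).
  { intros q r [n Hn] [m Hm]. exists (n + m).
    split; [apply (scoped_le (n:=n))|apply (scoped_le (n:=m))]; auto; lia. }
  induction p; cbn; auto.
  - now exists 0.
  - exists (S (s + t)). lia.
  - exists (S (s + t)). lia.
  - destruct IHp as [n Hn]. exists n. apply (scoped_le (n:=n)); auto; lia.
  - destruct IHp as [n Hn]. exists n. apply (scoped_le (n:=n)); auto; lia.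
Qed.

Lemma derives_weaken (T : theory set_lang) G p : derives T G p ->
  forall G', incl G G' -> derives T G' p.
Proof.
  assert (cons : forall (q : sform) G G', incl G G' -> incl (q :: G) (q :: G')).
  { intros q G1 G2 H r [->|Hr]; [now left|right; auto]. }
  assert (mp : forall G G' : ctx, incl G G' ->
    incl (map (@shift set_lang) G) (map (@shift set_lang) G')).
  { intros G1 G2 H r Hr. apply in_map_iff in Hr. destruct Hr as [q [<- Hq]].
    apply in_map; auto. }
  induction 1; intros G' HG; try (now econstructor; eauto).
Qed.

(* The renaming is carried out by generalizing and instantiating the free
   variables one at a time; later instantiations decrement the earlier values,
   whence the [+ n]. *)
Lemma rename_valid (T : theory set_lang) p : (forall G, derives T G p) ->
  forall s G, derives T G (rename s p).
Proof.
  assert (step : forall n (s : nat -> nat) p, (forall G, derives T G p) -> forall G,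
    derives T G (rename (fun m => if m <? n then s m else m - n) p)).
  { induction n as [|n IH]; intros s q Hq G.
    - rewrite rename_id; auto. intros; cbn. lia.
    - assert (Hi : forall G, derives T G (@inst set_lang (s 0 + n) q)).
      { intros G'. apply AllE. now apply AllI. }
      specialize (IH (fun m => s (S m)) _ Hi G); unfold inst in IH.
      rewrite rename_comp in IH. erewrite rename_ext; [exact IH|].
      intros [|m]; cbn [tsubst term var set_lang].
      + destruct (Nat.ltb_spec 0 (S n)), (Nat.ltb_spec (s 0 + n) n); lia.
      + destruct (Nat.ltb_spec (S m) (S n)), (Nat.ltb_spec m n); lia. }
  intros Hp s G. destruct (scoped_bound p) as [n Hn].
  rewrite (rename_scoped (s' := fun m => if m <? n then s m else m - n) Hn).
  - now apply step.
  - intros m Hm. destruct (Nat.ltb_spec m n); lia.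
Qed.

Lemma rename_inst s x (p : sform) :
  rename s (@inst set_lang x p) = @inst set_lang (s x) (rename (@up set_lang s) p).
Proof.
  unfold inst. rewrite !rename_comp. apply rename_ext. now intros [|n].
Qed.

Lemma rename_shift s (p : sform) :
  rename (@up set_lang s) (shift p) = shift (rename s p).
Proof. unfold shift. rewrite !rename_comp. now apply rename_ext. Qed.

Lemma map_rename_shift s (G : ctx) :
  map (rename (@up set_lang s)) (map (@shift set_lang) G)
  = map (@shift set_lang) (map (rename s) G).
Proof. rewrite !map_map. apply map_ext. intros; apply rename_shift. Qed.

(** A renamed axiom need not be an axiom; [rename_valid] derives it instead. All other rules commute
    with renaming. *)
Lemma derives_rename (T : theory set_lang) G p : derives T G p ->
  forall s, derives T (map (rename s) G) (rename s p).
Proof.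
  induction 1; intros s'; try (now econstructor; eauto).
  - apply rename_valid. intros G'. now apply Ax.
  - apply Hyp. now apply in_map.
  - apply AllI. rewrite <- map_rename_shift. apply IHderives.
  - rewrite rename_inst. apply AllE. apply IHderives.
  - apply ExI with (t := s' t). change (derives T (map (rename s') G)
      (@inst set_lang (s' t) (rename (@up set_lang s') p))).
    rewrite <- rename_inst. apply IHderives.
  - eapply ExE; [apply IHderives1|].
    specialize (IHderives2 (@up set_lang s')). cbn [map] in IHderives2.
    rewrite map_rename_shift, rename_shift in IHderives2. exact IHderives2.
  - rewrite rename_inst. apply EqE with (s := s' s); [apply IHderives1|].
    rewrite <- rename_inst. apply IHderives2.
Qed.

Lemma ctx_fresh (G : ctx) : exists n, forall p, In p G -> scoped n p.
Proof.
  induction G as [|p G [n Hn]].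
  - exists 0. intros p [].
  - destruct (scoped_bound p) as [m Hm]. exists (n + m). intros q [->|Hq].
    + apply (scoped_le (n:=m)); auto; lia.
    + apply (scoped_le (n:=n)); auto; lia.
Qed.

(** Turns the fresh name [N] back into the bound variable [0], which yields the shifted contexts
    that [AllI] and [ExE] ask for. *)
Definition unfresh (N n : nat) : nat := if n =? N then 0 else S n.

Lemma unfresh_ctx N (G : ctx) : (forall p, In p G -> scoped N p) ->
  map (rename (unfresh N)) G = map (@shift set_lang) G.
Proof.
  intros H. apply map_ext_in. intros p Hp. unfold shift.
  apply (rename_scoped (H p Hp)). intros m Hm. cbn. unfold unfresh.
  destruct (Nat.eqb_spec m N); lia.
Qed.

Lemma unfresh_inst N (p : sform) : scoped (S N) p ->
  rename (unfresh N) (@inst set_lang N p) = p.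
Proof.
  intros H. unfold inst. rewrite rename_comp.
  rewrite <- (rename_id p (s := fun n => n)) at 2 by auto.
  apply (rename_scoped H). intros [|m] Hm; cbn; unfold unfresh.
  - now rewrite Nat.eqb_refl.
  - destruct (Nat.eqb_spec m N); lia.
Qed.

(** A single name beyond the scope of [G] and [p] is enough: renaming that instance by [unfresh]
    gives the premise of [AllI]. *)
Lemma AllI_names (T : theory set_lang) G p :
  (forall x, derives T G (@inst set_lang x p)) -> derives T G (All p).
Proof.
  intros H. destruct (ctx_fresh G) as [n Hn]. destruct (scoped_bound p) as [m Hm].
  assert (HG : forall q, In q G -> scoped (n + m) q).
  { intros q Hq. apply (scoped_le (n:=n)); auto; lia. }
  apply AllI. rewrite <- (unfresh_ctx HG), <- (unfresh_inst (N := n + m) (p := p)).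
  - apply derives_rename, H.
  - apply (scoped_le (n:=m)); auto; lia.
Qed.

Lemma ExE_names (T : theory set_lang) G p r : derives T G (Ex p) ->
  (forall x, derives T (@inst set_lang x p :: G) r) -> derives T G r.
Proof.
  intros Hp H. destruct (ctx_fresh (r :: G)) as [n Hn].
  destruct (scoped_bound p) as [m Hm].
  assert (HG : forall q, In q (r :: G) -> scoped (n + m) q).
  { intros q Hq. apply (scoped_le (n:=n)); auto; lia. }
  apply (ExE Hp).
  specialize (derives_rename (H (n + m)) (unfresh (n + m))) as D. cbn [map] in D.
  rewrite unfresh_inst in D by (apply (scoped_le (n:=m)); auto; lia).
  pose proof (unfresh_ctx HG) as E. cbn [map] in E. injection E as E1 E2.
  rewrite E1, E2 in D. exact D.
Qed.

(** * Forcing over contexts *)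

Notation CC := (extend INF church_counting).

(* The second-order clauses of [oor] and [oex] and the closure [force_stable]
   allow case analysis whenever the goal is itself forced. *)
Record Om := MkOm {
  force :> ctx -> Prop;
  force_mono : forall w w', incl w w' -> force w -> force w';
  force_stable : forall w,
    (forall w' r, incl w w' ->
      (forall w'', incl w' w'' -> force w'' -> derives CC w'' r) ->
      derives CC w' r) -> force w
}.

Declare Scope om_scope.
Delimit Scope om_scope with om.
Bind Scope om_scope with Om.

Notation "w ||- P" := (force P%om w) (at level 75).

Definition oatom (p : sform) : Om.
Proof.
  refine (MkOm (force := fun w => derives CC w p) _ _).
  - intros w w' H D. exact (derives_weaken D H).
  - intros w H. apply H; auto. apply incl_refl.
Defined.

Definition oand (P Q : Om) : Om.
Proof.
  refine (MkOm (force := fun w => w ||- P /\ w ||- Q) _ _).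
  - intros w w' H [HP HQ]. split; eapply force_mono; eauto.
  - intros w H. split; apply force_stable; intros w' r Hw K; apply H; auto;
      intros w'' Hw' [HP HQ]; auto.
Defined.

Definition oimp (P Q : Om) : Om.
Proof.
  refine (MkOm (force := fun w => forall w', incl w w' -> w' ||- P -> w' ||- Q) _ _).
  - intros w w' H HPQ w'' H' HP. apply HPQ; auto. eapply incl_tran; eauto.
  - intros w H w1 H1 HP. apply force_stable. intros w' r Hw K. apply H.
    + eapply incl_tran; eauto.
    + intros w'' Hw'' HPQ. apply K; auto. apply HPQ; [apply incl_refl|].
      apply (force_mono (w := w1)); auto. eapply incl_tran; eauto.
Defined.

Definition oor (P Q : Om) : Om.
Proof.
  refine (MkOm (force := fun w => forall w' r, incl w w' ->
    (forall w'', incl w' w'' -> w'' ||- P -> derives CC w'' r) ->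
    (forall w'', incl w' w'' -> w'' ||- Q -> derives CC w'' r) ->
    derives CC w' r) _ _).
  - intros w w' H D w1 r H1. apply D. eapply incl_tran; eauto.
  - intros w H w1 r H1 KP KQ. apply H; auto. intros w2 H2 D.
    apply D; [apply incl_refl| |]; intros w3 H3; [apply KP|apply KQ];
      eapply incl_tran; eauto.
Defined.

Definition oall (P : nat -> Om) : Om.
Proof.
  refine (MkOm (force := fun w => forall x, w ||- P x) _ _).
  - intros w w' H D x. eapply force_mono; eauto.
  - intros w H x. apply force_stable. intros w1 r H1 K. apply H; auto.
Defined.

Definition oex (P : nat -> Om) : Om.
Proof.
  refine (MkOm (force := fun w => forall w' r, incl w w' ->
    (forall x w'', incl w' w'' -> w'' ||- P x -> derives CC w'' r) ->
    derives CC w' r) _ _).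
  - intros w w' H D w1 r H1. apply D. eapply incl_tran; eauto.
  - intros w H w1 r H1 K. apply H; auto. intros w2 H2 D.
    apply D; [apply incl_refl|]. intros x w3 H3. apply K.
    eapply incl_tran; eauto.
Defined.

Definition obot : Om := oatom Bot.
Definition oeq (x y : nat) : Om := oatom (set_eq x y).
Definition omem (x y : nat) : Om := oatom (set_mem x y).
Definition oiff (P Q : Om) : Om := oand (oimp P Q) (oimp Q P).

Notation "x 'in_' y" := (omem x y) (at level 70) : om_scope.
Notation "x == y" := (oeq x y) (at level 70) : om_scope.
Notation "P /\ Q" := (oand P Q) : om_scope.
Notation "P \/ Q" := (oor P Q) : om_scope.
Notation "P -> Q" := (oimp P Q) : om_scope.
Notation "P <-> Q" := (oiff P Q) : om_scope.
Notation "~ P" := (oimp P obot) : om_scope.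
Notation "'all' x .. y , P" :=
  (oall (fun x => .. (oall (fun y => P%om)) ..))
  (at level 200, x binder, y binder, right associativity) : om_scope.
Notation "'ex' x .. y , P" :=
  (oex (fun x => .. (oex (fun y => P%om)) ..))
  (at level 200, x binder, y binder, right associativity) : om_scope.

(** * Formulas as forced propositions, and agreement with derivability *)

Fixpoint sem (e : nat -> nat) (p : sform) : Om :=
  match p with
  | Bot => obot
  | Eq x y => oeq (e x) (e y)
  | Rel _ x y => omem (e x) (e y)
  | And p q => oand (sem e p) (sem e q)
  | Or p q => oor (sem e p) (sem e q)
  | Imp p q => oimp (sem e p) (sem e q)
  | All p => oall (fun x => sem (x .: e) p)
  | Ex p => oex (fun x => sem (x .: e) p)
  end.

Unset Implicit Arguments.

Lemma inst_rename_up x e p :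
  @inst set_lang x (rename (@up set_lang e) p) = rename (x .: e) p.
Proof. unfold inst. rewrite rename_comp. apply rename_ext. now intros [|n]. Qed.

(** The second-order clauses have the shape of [OrE] and [ExE_names]; in the other direction they
    are instantiated with the formula itself as [r]. Variables are the only terms of set theory, so
    names suffice as witnesses. *)
Lemma sem_derives p : forall w e, w ||- sem e p <-> derives CC w (rename e p).
Proof.
  assert (inc : forall (q : sform) (w : ctx), incl w (q :: w)).
  { intros q w r. now right. }
  induction p; intros w e; cbn [sem].
  - reflexivity.
  - reflexivity.
  - destruct r. reflexivity.
  - cbn. rewrite IHp1, IHp2. split.
    + intros [H1 H2]. now apply AndI.
    + intros H. split; [eapply AndE1|eapply AndE2]; exact H.
  - cbn. split.
    + intros H. apply H; [apply incl_refl| |]; intros w' _ D.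
      * apply OrI1, IHp1, D.
      * apply OrI2, IHp2, D.
    + intros H w' r Hw K1 K2. apply (OrE (derives_weaken H Hw)).
      * apply K1; auto. apply IHp1, Hyp. now left.
      * apply K2; auto. apply IHp2, Hyp. now left.
  - cbn. split.
    + intros H. apply ImpI, IHp2, H; auto. apply IHp1, Hyp. now left.
    + intros H w' Hw D. apply IHp2. eapply ImpE; [apply (derives_weaken H Hw)|].
      apply IHp1, D.
  - cbn. split.
    + intros H. apply AllI_names. intros x. rewrite inst_rename_up. apply IHp, H.
    + intros H x. apply IHp. rewrite <- inst_rename_up. now apply AllE.
  - cbn. split.
    + intros H. apply H; [apply incl_refl|]. intros x w' _ D.
      apply ExI with (t := x). rewrite inst_rename_up. apply IHp, D.
    + intros H w' r Hw K. apply (ExE_names (derives_weaken H Hw)).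
      intros x. apply (K x); auto. apply IHp, Hyp. left.
      now rewrite <- inst_rename_up.
Qed.

Lemma sem_valid {p} : (forall w e, w ||- sem e p) -> provable CC p.
Proof.
  intros H. unfold provable. rewrite <- (rename_id p (s := fun n => n)) by auto.
  apply sem_derives, H.
Qed.

Lemma sem_axiom {p} : CC p -> forall w e, w ||- sem e p.
Proof.
  intros H w e. apply sem_derives. apply rename_valid. intros G. now apply Ax.
Qed.

Lemma sem_rename p : forall s e w,
  w ||- sem e (rename s p) <-> w ||- sem (fun n => e (s n)) p.
Proof. intros. now rewrite !sem_derives, rename_comp. Qed.

Lemma sem_ext {p e e' w} : (forall n, e n = e' n) -> w ||- sem e p -> w ||- sem e' p.
Proof. intros H. now rewrite !sem_derives, (rename_ext _ H). Qed.

Lemma sem_eq {p x y e w} : w ||- x == y -> w ||- sem (x .: e) p -> w ||- sem (y .: e) p.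
Proof.
  rewrite !sem_derives, <- !inst_rename_up. intros E. now apply EqE.
Qed.

(** * Rules for the forced connectives and equality *)

Lemma oimp_intro {P Q : Om} {w} :
  (forall w', incl w w' -> w' ||- P -> w' ||- Q) -> w ||- (P -> Q).
Proof. auto. Qed.

Lemma oimp_elim {P Q : Om} {w} : w ||- (P -> Q) -> w ||- P -> w ||- Q.
Proof. intros H. apply H, incl_refl. Qed.

Lemma oiff_elim1 {P Q : Om} {w} : w ||- (P <-> Q) -> w ||- P -> w ||- Q.
Proof. intros [H _]. now apply oimp_elim. Qed.

Lemma oiff_elim2 {P Q : Om} {w} : w ||- (P <-> Q) -> w ||- Q -> w ||- P.
Proof. intros [_ H]. now apply oimp_elim. Qed.

Lemma oor_intro1 {P} (Q : Om) {w} : w ||- P -> w ||- (P \/ Q).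
Proof. intros H w' r Hw K _. apply K; [apply incl_refl|]. eapply force_mono; eauto. Qed.

Lemma oor_intro2 (P : Om) {Q} {w} : w ||- Q -> w ||- (P \/ Q).
Proof. intros H w' r Hw _ K. apply K; [apply incl_refl|]. eapply force_mono; eauto. Qed.

Lemma oor_elim {P Q R : Om} {w} : w ||- (P \/ Q) ->
  (forall w', incl w w' -> w' ||- P -> w' ||- R) ->
  (forall w', incl w w' -> w' ||- Q -> w' ||- R) -> w ||- R.
Proof.
  intros H HP HQ. apply force_stable. intros w' r Hw K.
  apply (H w' r Hw); intros w'' Hw' D; apply K; auto;
    [apply HP|apply HQ]; auto; eapply incl_tran; eauto.
Qed.

Lemma oex_intro {P : nat -> Om} x {w} : w ||- P x -> w ||- oex P.
Proof.
  intros H w' r Hw K. apply (K x); [apply incl_refl|]. eapply force_mono; eauto.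
Qed.

Lemma oex_elim {P : nat -> Om} {R : Om} {w} : w ||- oex P ->
  (forall x w', incl w w' -> w' ||- P x -> w' ||- R) -> w ||- R.
Proof.
  intros H HP. apply force_stable. intros w' r Hw K.
  apply (H w' r Hw); intros x w'' Hw' D; apply K; auto.
  apply (HP x); auto; eapply incl_tran; eauto.
Qed.

Lemma obot_elim {P : Om} {w} : w ||- obot -> w ||- P.
Proof.
  intros H. apply force_stable. intros w' r Hw _. apply BotE.
  exact (derives_weaken H Hw).
Qed.

Lemma oeq_refl x w : w ||- x == x.
Proof. apply EqI. Qed.

Lemma oeq_sym {x y w} : w ||- x == y -> w ||- y == x.
Proof.
  intros H. exact (sem_eq (p := set_eq 0 1) (e := x .: fun n => n) H (oeq_refl x w)).
Qed.

Lemma oeq_trans {x y z w} : w ||- x == y -> w ||- y == z -> w ||- x == z.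
Proof.
  intros H K. apply oeq_sym in H.
  exact (sem_eq (p := set_eq 0 1) (e := z .: fun n => n) H K).
Qed.

(** A function [nat -> Om] need not come from a formula, so the replacement of equals, which [EqE]
    gives for formulas only, is built up along the connectives. *)
Definition respectful (P : nat -> Om) : Prop :=
  forall w x y, w ||- x == y -> w ||- P x -> w ||- P y.

Lemma resp_const P : respectful (fun _ => P).
Proof. intros w x y _ H. exact H. Qed.

Lemma resp_bin (op : nat -> nat -> sform) (a b : nat -> nat) :
  (op = set_eq \/ op = set_mem) ->
  (forall w x y, w ||- x == y -> w ||- a x == a y) ->
  (forall w x y, w ||- x == y -> w ||- b x == b y) ->
  respectful (fun x => oatom (op (a x) (b x))).
Proof.
  intros Hop Ha Hb w x y E H. specialize (Ha w x y E). specialize (Hb w x y E).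
  assert (Hr : forall u v : nat, rename (u .: v .: fun n => n) (op 0 1) = op u v).
  { destruct Hop; subst; reflexivity. }
  assert (Hr' : forall u v : nat, rename (u .: v .: fun n => n) (op 1 0) = op v u).
  { destruct Hop; subst; reflexivity. }
  (* Both sides may depend on the variable: the left one is replaced first, then the right one, each
     time by [sem_eq] for an atomic formula in two variables. *)
  assert (H1 : w ||- oatom (op (a y) (b x))).
  { cbn. rewrite <- Hr. apply sem_derives. eapply sem_eq; [exact Ha|].
    apply sem_derives. rewrite Hr. exact H. }
  cbn. rewrite <- Hr'. apply sem_derives. eapply sem_eq; [exact Hb|].
  apply sem_derives. rewrite Hr'. exact H1.
Qed.

Lemma resp_and {P Q} : respectful P -> respectful Q ->
  respectful (fun x => P x /\ Q x)%om.
Proof. intros HP HQ w x y E [H1 H2]. split; eauto. Qed.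

Lemma resp_imp {P Q} : respectful P -> respectful Q ->
  respectful (fun x => P x -> Q x)%om.
Proof.
  intros HP HQ w x y E H w' Hw D. pose proof (force_mono Hw E) as E'.
  apply (HQ w' x y E'). apply H; auto. apply (HP w' y x); auto.
  now apply oeq_sym.
Qed.

Lemma resp_iff {P Q} : respectful P -> respectful Q ->
  respectful (fun x => P x <-> Q x)%om.
Proof. intros. apply resp_and; apply resp_imp; auto. Qed.

Lemma resp_or {P Q} : respectful P -> respectful Q ->
  respectful (fun x => P x \/ Q x)%om.
Proof.
  intros HP HQ w x y E H. apply (oor_elim H); intros w' Hw D;
    pose proof (force_mono Hw E) as E'.
  - apply oor_intro1. eauto.
  - apply oor_intro2. eauto.
Qed.

Lemma resp_all {P} : (forall z, respectful (fun x => P x z)) ->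
  respectful (fun x => oall (P x)).
Proof. intros HP w x y E H z. apply (HP z w x y E), H. Qed.

Lemma resp_ex {P} : (forall z, respectful (fun x => P x z)) ->
  respectful (fun x => oex (P x)).
Proof.
  intros HP w x y E H. apply (oex_elim H). intros z w' Hw D.
  apply (oex_intro z). apply (HP z w' x y); auto.
  exact (force_mono Hw E).
Qed.

Ltac resp :=
  lazymatch goal with
  | |- respectful (fun _ => ?P) => apply (resp_const P)
  | |- respectful (fun x => oand _ _) => apply resp_and; resp
  | |- respectful (fun x => oimp _ _) => apply resp_imp; resp
  | |- respectful (fun x => oiff _ _) => apply resp_iff; resp
  | |- respectful (fun x => oor _ _) => apply resp_or; resp
  | |- respectful (fun x => oall _) => apply resp_all; intro; cbv beta; resp
  | |- respectful (fun x => oex _) => apply resp_ex; intro; cbv beta; resp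
  | |- respectful (fun x => oeq (@?a x) (@?b x)) =>
      apply (resp_bin set_eq a b); [left; reflexivity| |];
      intros ? ? ?; first [exact (fun H => H) | intros _; apply oeq_refl]
  | |- respectful (fun x => omem (@?a x) (@?b x)) =>
      apply (resp_bin set_mem a b); [right; reflexivity| |];
      intros ? ? ?; first [exact (fun H => H) | intros _; apply oeq_refl]
  | |- respectful (fun x => ?h _ _ _ _ _) => unfold h; resp
  | |- respectful (fun x => ?h _ _ _ _) => unfold h; resp
  | |- respectful (fun x => ?h _ _ _) => unfold h; resp
  | |- respectful (fun x => ?h _ _) => unfold h; resp
  | |- respectful (fun x => ?h _) => unfold h; resp
  | |- respectful ?F => change (respectful (fun x => F x)); resp
  end.

(* All hypotheses are forced at one current world [w]; a rule that enlarges the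
   world moves them along. *)
Ltac move_world H w w' :=
  repeat match goal with
  | K : force _ w |- _ => apply (force_mono H) in K
  end; clear H; try clear w; rename w' into w.

Tactic Notation "fintro" ident(H) :=
  lazymatch goal with
  | |- force _ ?w =>
      let w' := fresh "w" in let Hw := fresh "Hw" in
      apply oimp_intro; intros w' Hw H; move_world Hw w w'
  end.

Tactic Notation "fdes" constr(K) "as" ident(x) simple_intropattern(H) :=
  lazymatch goal with
  | |- force _ ?w =>
      let w' := fresh "w" in let Hw := fresh "Hw" in
      apply (oex_elim K); intros x w' Hw H; move_world Hw w w'
  end.

Tactic Notation "fcase" constr(K) "as" simple_intropattern(H) :=
  lazymatch goal with
  | |- force _ ?w =>
      let w' := fresh "w" in let Hw := fresh "Hw" in
      apply (oor_elim K); intros w' Hw H; move_world Hw w w'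
  end.

Ltac fexists x := apply (oex_intro x); cbv beta.

(* [frw E H] with [E : w ||- x == y] replaces [x] by [y] in [H]. *)
Ltac frw E H :=
  lazymatch type of E with force (oeq ?x ?y) ?w =>
    let t := type of H in
    lazymatch t with force ?P w =>
      let P' := eval pattern x in P in
      lazymatch P' with ?F _ =>
        let R := fresh in
        assert (R : respectful F) by resp;
        apply (R w x y E) in H; cbv beta in H; clear R
      end
    end
  end.

Ltac frwg E :=
  lazymatch type of E with force (oeq ?x ?y) ?w =>
    lazymatch goal with |- force ?P w =>
      let P' := eval pattern y in P in
      lazymatch P' with ?F _ =>
        let R := fresh in
        assert (R : respectful F) by resp;
        apply (R w x y E); cbv beta; clear R
      end
    end
  end.

(* Replaces [x] by [y] everywhere, where [E : w ||- x == y]. *)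
Ltac fsubst E :=
  lazymatch type of E with force (oeq ?x ?y) ?w =>
    repeat match goal with
    | K : force ?P w |- _ =>
        lazymatch K with E => fail | _ => idtac end;
        lazymatch P with context [x] => frw E K end
    end;
    try (lazymatch goal with |- force ?P w =>
      lazymatch P with context [x] =>
        let E' := fresh in pose proof (oeq_sym E) as E'; frwg E'; clear E'
      end
    end);
    try clear E
  end.

Ltac fsplit :=
  lazymatch goal with
  | |- force (oand _ _) _ => split; fsplit
  | _ => idtac
  end.

(* Keeps conversion from comparing the closure proofs inside [Om]. *)
Strategy 100 [oall oex oand oor oimp oatom obot oeq omem].

(** * Pairs and the Church operations *)

Notation "x 'in_' y" := (h_mem x y) (at level 70) : hform_scope.
Notation "x == y" := (h_eq x y) (at level 70) : hform_scope.
Notation "p /\ q" := (h_and p q) : hform_scope.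
Notation "p \/ q" := (h_or p q) : hform_scope.
Notation "p -> q" := (h_imp p q) : hform_scope.
Notation "p <-> q" := (h_iff p q) : hform_scope.
Notation "'all' x .. y , p" :=
  (h_all (fun x => .. (h_all (fun y => p%hf)) ..))
  (at level 200, x binder, y binder, right associativity) : hform_scope.
Notation "'ex' x .. y , p" :=
  (h_ex (fun x => .. (h_ex (fun y => p%hf)) ..))
  (at level 200, x binder, y binder, right associativity) : hform_scope.

Definition env0 : nat -> nat := fun _ => 0.

(* The type constraints [e y = S (e x)] are solved by unification of the unknown
   types. *)
Ltac strat_goals :=
  lazymatch goal with
  | |- _ /\ _ => split; strat_goals
  | |- True => exact I
  | |- _ = _ => reflexivity
  | _ => eexists; strat_goals
  end.

(** Six unknown types cover the free variables of every formula to which comprehension is applied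
    through [strat]; those that unification leaves open are set to [0]. *)
Lemma stratified_intro {p} :
  (exists a b c d e f : nat, stratified_by (a .: b .: c .: d .: e .: f .: env0) p) ->
  stratified p.
Proof. intros [a [b [c [d [e [f H]]]]]]. eexists. exact H. Qed.

Ltac strat :=
  apply stratified_intro;
  unshelve (do 6 eexists; cbv; strat_goals); exact 0.

(** From here to [inN], counterparts of the [hform] definitions on names. [sem] of the latter
    reduces to the former, so comprehension and the counting axiom apply by conversion. *)
Definition sing x y : Om := (all z, (z in_ y <-> z == x))%om.
Definition upair x1 x2 y : Om := (all z, (z in_ y <-> z == x1 \/ z == x2))%om.
Definition pair x y u : Om := (all z, (z in_ u <-> sing x z \/ upair x y z))%om.
Definition pin x y f : Om := (ex u, (pair x y u /\ u in_ f))%om.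
Definition FUNC f : Om :=
  (all x y z, (pin x y f -> pin x z f -> y == z))%om.
Definition Ap f x v : Om :=
  (all t, (t in_ v <-> ex y, (pin x y f /\ t in_ y)))%om.
Definition isid i : Om := (all u, (u in_ i <-> ex x, (x == x /\ pair x x u)))%om.
Definition czero o : Om :=
  (all u, (u in_ o <-> ex f i, (f == f /\ isid i /\ pair f i u)))%om.
(** [p] is [z f] followed by [f], that is, the value at [f] of the successor of [z]. *)
Definition comp z f p : Om :=
  (all u, (u in_ p <-> ex x w t q,
     (pair x w u /\ FUNC t /\ pin f t z /\ pin x q t /\ pin q w f)))%om.
Definition sval z s : Om :=
  (all v, (v in_ s <-> ex f p, (pair f p v /\ FUNC f /\ comp z f p)))%om.
Definition csucc s : Om :=
  (all v, (v in_ s <-> ex z sz, (pair z sz v /\ FUNC z /\ sval z sz)))%om.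
Definition has_zero a : Om := (ex o, (czero o /\ o in_ a))%om.
Definition succ_closed a : Om :=
  (all x, (x in_ a -> ex s y, (csucc s /\ Ap s x y /\ y in_ a)))%om.
Definition inN j : Om := (all a, (has_zero a -> succ_closed a -> j in_ a))%om.

Lemma set_ext {w x y} : w ||- (all z, (z in_ x <-> z in_ y)) -> w ||- x == y.
Proof.
  intros H. apply (oimp_elim (P := (all z, (z in_ x <-> z in_ y))%om)); auto.
  assert (A : CC (Imp (All (Iff (set_mem 0 1) (set_mem 0 2))) (set_eq 0 1))).
  { left. apply INF_extensionality. }
  exact (sem_axiom A w (x .: y .: env0)).
Qed.

Lemma comprehension {p e w} : stratified p ->
  w ||- (ex y, all x, (x in_ y <-> sem (x .: e) p)).
Proof.
  intros Hp.
  assert (A := sem_axiom (or_introl (INF_comprehension Hp)) w e).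
  cbn [sem] in A. fdes A as y H. fexists y. intros x. specialize (H x).
  assert (K : forall w', w' ||- sem (x .: y .: e) (rename (fun n => match n with
     0 => 0 | S m => S (S m) end) p) <-> w' ||- sem (x .: e) p).
  { intros w'. rewrite sem_rename. split; apply sem_ext; now intros [|n]. }
  split; intros w' Hw D; [apply K|]; apply (force_mono Hw) in H.
  - exact (oiff_elim1 H D).
  - apply K in D. exact (oiff_elim2 H D).
Qed.

(** Each defined set term is specified by its members, so its uniqueness is an instance of this. *)
Lemma def_unique {w} {P : nat -> Om} {a b} : w ||- (all z, (z in_ a <-> P z)) ->
  w ||- (all z, (z in_ b <-> P z)) -> w ||- a == b.
Proof.
  intros Ha Hb. apply set_ext. intros z. specialize (Ha z). specialize (Hb z).
  split; fintro H.
  - exact (oiff_elim2 Hb (oiff_elim1 Ha H)).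
  - exact (oiff_elim2 Ha (oiff_elim1 Hb H)).
Qed.

Lemma sing_ex x w : w ||- (ex y, sing x y).
Proof.
  (* At depth [d] the name [d - 1] is index [0], the element of the new set; smaller names are the
     parameters, listed in [e] from the largest name down. *)
  refine (comprehension (p := (1 == 0)%hf 2) (e := x .: env0) _). strat.
Qed.

Lemma upair_ex x y w : w ||- (ex z, upair x y z).
Proof.
  refine (comprehension (p := (2 == 0 \/ 2 == 1)%hf 3) (e := y .: x .: env0) _). strat.
Qed.

Lemma pair_ex x y w : w ||- (ex u, pair x y u).
Proof.
  refine (comprehension (p := (is_singleton 0 2 \/ is_unordered_pair 0 1 2)%hf 3)
    (e := y .: x .: env0) _). strat.
Qed.

(** The set [{x}] belongs to [u], so it is [{x'}] or [{x', y'}]; in both cases it contains [x']. *)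
Lemma pair_fst {x y x' y' u w} :
  w ||- pair x y u -> w ||- pair x' y' u -> w ||- x == x'.
Proof.
  intros H H'. fdes (sing_ex x w) as s Hs.
  assert (D := oiff_elim2 (H s) (oor_intro1 _ Hs)).
  assert (D' := oiff_elim1 (H' s) D).
  apply oeq_sym. apply (oiff_elim1 (Hs x')).
  fcase D' as K.
  - exact (oiff_elim2 (K x') (oeq_refl _ _)).
  - exact (oiff_elim2 (K x') (oor_intro1 _ (oeq_refl _ _))).
Qed.

Lemma pair_snd_aux {x y y' u w} : w ||- pair x y u -> w ||- pair x y' u ->
  w ||- (y == x \/ y == y').
Proof.
  intros H H'. fdes (upair_ex x y w) as s Hs.
  assert (D := oiff_elim2 (H s) (oor_intro2 _ Hs)).
  assert (D' := oiff_elim1 (H' s) D).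
  assert (E := oiff_elim2 (Hs y) (oor_intro2 _ (oeq_refl _ _))).
  fcase D' as K.
  - apply oor_intro1. exact (oiff_elim1 (K y) E).
  - exact (oiff_elim1 (K y) E).
Qed.

(** The first components agree, so [y] is [x'] or [y'], and by symmetry [y'] is [x'] or [y]; every
    combination gives [y = y'], without deciding whether the components coincide. *)
Lemma pair_snd {x y x' y' u w} :
  w ||- pair x y u -> w ||- pair x' y' u -> w ||- y == y'.
Proof.
  intros H H'. assert (E := pair_fst H H'). frw E H.
  fcase (pair_snd_aux H H') as K; [|exact K].
  fcase (pair_snd_aux H' H) as K'.
  - exact (oeq_trans K (oeq_sym K')).
  - exact (oeq_sym K').
Qed.

Lemma pin_intro {x y u f w} : w ||- pair x y u -> w ||- u in_ f -> w ||- pin x y f.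
Proof. intros. fexists u. now split. Qed.

Lemma id_ex w : w ||- (ex i, isid i).
Proof.
  refine (comprehension (p := (ex x, x == x /\ is_pair x x 0)%hf 1) (e := env0) _). strat.
Qed.

Lemma isid_unique {i j w} : w ||- isid i -> w ||- isid j -> w ||- i == j.
Proof. apply def_unique. Qed.

Lemma pin_id {i} x y {w} : w ||- isid i -> w ||- (pin x y i <-> x == y).
Proof.
  intros Hi. split; fintro H.
  - fdes H as u [Hu Hm]. fdes (oiff_elim1 (Hi u) Hm) as z [_ Hz].
    exact (oeq_trans (pair_fst Hu Hz) (oeq_sym (pair_snd Hu Hz))).
  - fsubst H. fdes (pair_ex y y w) as u Hu. apply (pin_intro Hu).
    apply (oiff_elim2 (Hi u)). fexists y. now split; [apply oeq_refl|].
Qed.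

Lemma FUNC_id {i w} : w ||- isid i -> w ||- FUNC i.
Proof.
  intros Hi x y z. fintro H. fintro K.
  exact (oeq_trans (oeq_sym (oiff_elim1 (pin_id _ _ Hi) H))
    (oiff_elim1 (pin_id _ _ Hi) K)).
Qed.

Lemma zero_ex w : w ||- (ex o, czero o).
Proof.
  refine (comprehension (p := (ex f i, f == f /\ is_id i /\ is_pair f i 0)%hf 1)
    (e := env0) _). strat.
Qed.

Lemma zero_unique {o o' w} : w ||- czero o -> w ||- czero o' -> w ||- o == o'.
Proof. apply def_unique. Qed.

Lemma pin_zero {o} f t {w} : w ||- czero o -> w ||- (pin f t o <-> isid t).
Proof.
  intros Ho. split; fintro H.
  - fdes H as u [Hu Hm]. fdes (oiff_elim1 (Ho u) Hm) as g Hg.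
    fdes Hg as i [_ [Hi Hp]]. frwg (pair_snd Hp Hu). exact Hi.
  - fdes (pair_ex f t w) as u Hu. apply (pin_intro Hu).
    apply (oiff_elim2 (Ho u)). fexists f. fexists t.
    split; [apply oeq_refl|now split].
Qed.

Lemma FUNC_zero {o w} : w ||- czero o -> w ||- FUNC o.
Proof.
  intros Ho x y z. fintro H. fintro K.
  exact (isid_unique (oiff_elim1 (pin_zero _ _ Ho) H)
    (oiff_elim1 (pin_zero _ _ Ho) K)).
Qed.

Lemma comp_ex z f w : w ||- (ex p, comp z f p).
Proof.
  refine (comprehension (p := (ex x w t q,
     is_pair x w 2 /\ in_FUNC t /\ pair_in 1 t 0 /\
     pair_in x q t /\ pair_in q w 1)%hf 3) (e := f .: z .: env0) _). strat.
Qed.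

Lemma comp_unique {z f p q w} : w ||- comp z f p -> w ||- comp z f q -> w ||- p == q.
Proof. apply def_unique. Qed.

Lemma pin_comp {z f p} x y {w} : w ||- comp z f p -> w ||- (pin x y p <->
  ex t q, (FUNC t /\ pin f t z /\ pin x q t /\ pin q y f)).
Proof.
  intros Hp. split; fintro H.
  - fdes H as u [Hu Hm]. fdes (oiff_elim1 (Hp u) Hm) as x' Hx.
    fdes Hx as y' Hy. fdes Hy as t Ht. fdes Ht as q Hq.
    destruct Hq as [H1 [H2 [H3 [H4 H5]]]]. fexists t. fexists q.
    assert (Ex := pair_fst H1 Hu). assert (Ey := pair_snd H1 Hu).
    fsubst Ex. fsubst Ey. now fsplit.
  - fdes H as t Ht. fdes Ht as q Hq.
    fdes (pair_ex x y w) as u Hu. apply (pin_intro Hu).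
    apply (oiff_elim2 (Hp u)). fexists x. fexists y. fexists t. fexists q.
    now split.
Qed.

Lemma FUNC_comp {z f p w} : w ||- FUNC z -> w ||- FUNC f -> w ||- comp z f p ->
  w ||- FUNC p.
Proof.
  intros Hz Hf Hp x y y'. fintro H. fintro K.
  apply (oiff_elim1 (pin_comp _ _ Hp)) in H, K.
  fdes H as t Ht. fdes Ht as q Hq. fdes K as t' Ht'. fdes Ht' as q' Hq'.
  destruct Hq as [H1 [H2 [H3 H4]]], Hq' as [K1 [K2 [K3 K4]]].
  assert (E := oimp_elim (oimp_elim (Hz f t t') H2) K2). fsubst E.
  assert (E' := oimp_elim (oimp_elim (K1 x q q') H3) K3). fsubst E'.
  exact (oimp_elim (oimp_elim (Hf q' y y') H4) K4).
Qed.

Lemma sval_ex z w : w ||- (ex s, sval z s).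
Proof.
  refine (comprehension (p := (ex f p, is_pair f p 1 /\ in_FUNC f /\
     all u, u in_ p <-> ex x w t q,
       is_pair x w u /\ in_FUNC t /\ pair_in f t 0 /\
       pair_in x q t /\ pair_in q w f)%hf 2) (e := z .: env0) _). strat.
Qed.

Lemma sval_unique {z s s' w} : w ||- sval z s -> w ||- sval z s' -> w ||- s == s'.
Proof. apply def_unique. Qed.

Lemma pin_sval {z s} f p {w} : w ||- sval z s ->
  w ||- (pin f p s <-> FUNC f /\ comp z f p).
Proof.
  intros Hs. split; fintro H.
  - fdes H as u [Hu Hm]. fdes (oiff_elim1 (Hs u) Hm) as x Hx.
    fdes Hx as y [H1 [H2 H3]].
    assert (Ex := pair_fst H1 Hu). assert (Ey := pair_snd H1 Hu).
    fsubst Ex. fsubst Ey. now split.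
  - fdes (pair_ex f p w) as u Hu. apply (pin_intro Hu).
    apply (oiff_elim2 (Hs u)). fexists f. fexists p. now split.
Qed.

Lemma FUNC_sval {z s w} : w ||- sval z s -> w ||- FUNC s.
Proof.
  intros Hs f p q. fintro H. fintro K.
  apply (oiff_elim1 (pin_sval _ _ Hs)) in H, K.
  exact (comp_unique (proj2 H) (proj2 K)).
Qed.

Lemma succ_ex w : w ||- (ex s, csucc s).
Proof.
  refine (comprehension (p := (ex z sz,
     is_pair z sz 0 /\ in_FUNC z /\ is_church_succ_value z sz)%hf 1) (e := env0) _). strat.
Qed.

Lemma succ_unique {s s' w} : w ||- csucc s -> w ||- csucc s' -> w ||- s == s'.
Proof. apply def_unique. Qed.

Lemma pin_succ {s} x y {w} : w ||- csucc s -> w ||- (pin x y s <-> FUNC x /\ sval x y).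
Proof.
  intros Hs. split; fintro H.
  - fdes H as u [Hu Hm]. fdes (oiff_elim1 (Hs u) Hm) as x' Hx.
    fdes Hx as y' [H1 [H2 H3]].
    assert (Ex := pair_fst H1 Hu). assert (Ey := pair_snd H1 Hu).
    fsubst Ex. fsubst Ey. now split.
  - fdes (pair_ex x y w) as u Hu. apply (pin_intro Hu).
    apply (oiff_elim2 (Hs u)). fexists x. fexists y. now split.
Qed.

Lemma FUNC_succ {s w} : w ||- csucc s -> w ||- FUNC s.
Proof.
  intros Hs f p q. fintro H. fintro K.
  apply (oiff_elim1 (pin_succ _ _ Hs)) in H, K.
  exact (sval_unique (proj2 H) (proj2 K)).
Qed.

Lemma FUNC_pin {f x y z w} :
  w ||- FUNC f -> w ||- pin x y f -> w ||- pin x z f -> w ||- y == z.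
Proof. intros Hf H K. exact (oimp_elim (oimp_elim (Hf x y z) H) K). Qed.

(** [Ap] is the union of all values of [f] at [x]; if [y] is the only value, the union is [y]. *)
Lemma Ap_pin {f x y w} : w ||- FUNC f -> w ||- pin x y f -> w ||- Ap f x y.
Proof.
  intros Hf H t. split; fintro K.
  - fexists y. now split.
  - fdes K as z [H1 H2]. assert (E := FUNC_pin Hf H1 H). fsubst E. exact H2.
Qed.

Lemma Ap_unique {f x y z w} : w ||- Ap f x y -> w ||- Ap f x z -> w ||- y == z.
Proof. apply def_unique. Qed.

(** * Church numbers *)

(** The components of a pair are recovered only up to derivable equality, hence the respectfulness
    of [P] in each argument. *)
Lemma pin_relation {P : nat -> nat -> Om} {f} x y {w} :
  (forall y, respectful (fun x => P x y)) -> (forall x, respectful (P x)) ->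
  w ||- (all u, (u in_ f <-> ex x y, (pair x y u /\ P x y))) ->
  w ||- (pin x y f <-> P x y).
Proof.
  intros RP RP' Hf. split; fintro H.
  - fdes H as u [Hu Hm]. fdes (oiff_elim1 (Hf u) Hm) as x' Hx.
    fdes Hx as y' [H1 H2].
    apply (RP' x w y' y (pair_snd H1 Hu)), (RP y' w x' x (pair_fst H1 Hu)), H2.
  - fdes (pair_ex x y w) as u Hu. apply (pin_intro Hu).
    apply (oiff_elim2 (Hf u)). fexists x. fexists y. now split.
Qed.

Lemma sval_Ap {s x y w} : w ||- csucc s -> w ||- FUNC x -> w ||- sval x y ->
  w ||- Ap s x y.
Proof.
  intros Hs Hx Hy. apply Ap_pin.
  - exact (FUNC_succ Hs).
  - apply (oiff_elim2 (pin_succ x y Hs)). now split.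
Qed.

(** [FUNC] is a set that contains zero and is closed under successor, since zero and all successor
    values are single-valued. *)
Lemma N_FUNC {j w} : w ||- inN j -> w ||- FUNC j.
Proof.
  intros Hj.
  assert (C : w ||- (ex a, all x, (x in_ a <-> FUNC x))).
  { refine (comprehension (p := (in_FUNC 0)%hf 1) (e := env0) _). strat. }
  fdes C as a Ha. apply (oiff_elim1 (Ha j)).
  apply (oimp_elim (P := succ_closed a)); [apply (oimp_elim (P := has_zero a))|].
  - exact (Hj a).
  - fdes (zero_ex w) as o Ho. fexists o. split; auto.
    exact (oiff_elim2 (Ha o) (FUNC_zero Ho)).
  - intros x. fintro Hx. fdes (succ_ex w) as s Hs. fdes (sval_ex x w) as y Hy.
    fexists s. fexists y. fsplit; auto.
    + exact (sval_Ap Hs (oiff_elim1 (Ha x) Hx) Hy).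
    + exact (oiff_elim2 (Ha y) (FUNC_sval Hy)).
Qed.

Lemma N_zero {o w} : w ||- czero o -> w ||- inN o.
Proof.
  intros Ho a. fintro Hz. fintro Hs. fdes Hz as o' [H1 H2].
  assert (E := zero_unique H1 Ho). fsubst E. exact H2.
Qed.

Lemma N_succ {x y w} : w ||- inN x -> w ||- sval x y -> w ||- inN y.
Proof.
  intros Hx Hy a. fintro Hz. fintro Hs.
  assert (Hm := oimp_elim (oimp_elim (Hx a) Hz) Hs).
  fdes (oimp_elim (Hs x) Hm) as s H. fdes H as y' [H1 [H2 H3]].
  assert (E := Ap_unique H2 (sval_Ap H1 (N_FUNC Hx) Hy)). fsubst E. exact H3.
Qed.

Lemma N_ind {P : nat -> Om} {j w} :
  w ||- (ex a, all x, (x in_ a <-> P x)) ->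
  w ||- (all o, (czero o -> P o)) ->
  w ||- (all x y, (inN x -> P x -> sval x y -> P y)) ->
  w ||- inN j -> w ||- P j.
Proof.
  intros C HO HS Hj. fdes C as b Hb.
  (* Closure speaks of [Ap s x], which is the successor value only for functions [x]. Intersecting
     with [N] ensures this and supplies [inN x] in the induction step. *)
  assert (C' : w ||- (ex a, all x, (x in_ a <-> inN x /\ x in_ b))).
  { refine (comprehension (p := (in_N 1 /\ 1 in_ 0)%hf 2) (e := b .: env0) _). strat. }
  fdes C' as a Ha.
  apply (oiff_elim1 (Hb j)). apply (proj2 (A := w ||- inN j)).
  apply (oiff_elim1 (Ha j)).
  apply (oimp_elim (P := succ_closed a)); [apply (oimp_elim (P := has_zero a))|].
  - exact (Hj a).
  - fdes (zero_ex w) as o Ho. fexists o. split; auto.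
    apply (oiff_elim2 (Ha o)). split; [exact (N_zero Ho)|].
    exact (oiff_elim2 (Hb o) (oimp_elim (HO o) Ho)).
  - intros x. fintro Hx. apply (oiff_elim1 (Ha x)) in Hx. destruct Hx as [Hx Hxb].
    fdes (succ_ex w) as s Hs. fdes (sval_ex x w) as y Hy.
    fexists s. fexists y. fsplit; auto.
    + exact (sval_Ap Hs (N_FUNC Hx) Hy).
    + apply (oiff_elim2 (Ha y)). split; [exact (N_succ Hx Hy)|].
      apply (oiff_elim2 (Hb y)).
      exact (oimp_elim (oimp_elim (oimp_elim (HS x y) Hx)
        (oiff_elim1 (Hb x) Hxb)) Hy).
Qed.

(** * Counting, and the two successor axioms of arithmetic *)

Lemma counting {j w} : w ||- inN j ->
  w ||- (ex s o js, (csucc s /\ czero o /\ Ap j s js /\ Ap js o j)).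
Proof.
  intros Hj. refine (oimp_elim _ Hj).
  exact (sem_axiom (p := church_counting) (or_intror eq_refl) w env0 j).
Qed.

(** The universal set contains every pair, so if it were a function it would send [V] both to [V]
    and to the empty set. *)
Lemma not_FUNC_ex w : w ||- (ex a, ~ FUNC a).
Proof.
  assert (C : w ||- (ex a, all x, (x in_ a <-> x == x))).
  { refine (comprehension (p := (0 == 0)%hf 1) (e := env0) _). strat. }
  assert (C' : w ||- (ex a, all x, (x in_ a <-> obot))).
  { refine (comprehension (p := Bot) (e := env0) _). strat. }
  fdes C as V HV. fdes C' as O HO. fexists V. fintro H.
  apply (oiff_elim1 (HO V)).
  assert (K : forall x y, w ||- pin x y V).
  { intros x y. fdes (pair_ex x y w) as u Hu. apply (pin_intro Hu).
    apply (oiff_elim2 (HV u)), oeq_refl. }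
  assert (E := FUNC_pin H (K V V) (K V O)). frwg E.
  apply (oiff_elim2 (HV V)), oeq_refl.
Qed.

Lemma zero_not_sval {z o w} : w ||- czero o -> w ||- sval z o -> w ||- obot.
Proof.
  intros Ho Hz. fdes (not_FUNC_ex w) as a Ha. fdes (id_ex w) as i Hi.
  apply (oimp_elim Ha). apply (proj1 (B := w ||- comp z a i)).
  apply (oiff_elim1 (pin_sval a i Hz)). exact (oiff_elim2 (pin_zero a i Ho) Hi).
Qed.

(** The graph of [n f x = y]. Unlike nested [Ap], which always has some value, it asserts that both
    applications are defined. *)
Definition iter n f x y : Om := (ex t, (FUNC t /\ pin f t n /\ pin x y t))%om.
Definition h_iter n f x y : hform :=
  (ex t, in_FUNC t /\ pair_in f t n /\ pair_in x y t)%hf.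

Lemma iter_unique {n f x y z w} : w ||- FUNC n ->
  w ||- iter n f x y -> w ||- iter n f x z -> w ||- y == z.
Proof.
  intros Hn H K. fdes H as t [H1 [H2 H3]]. fdes K as t' [K1 [K2 K3]].
  assert (E := FUNC_pin Hn H2 K2). fsubst E. exact (FUNC_pin K1 H3 K3).
Qed.

Lemma iter_zero {o} f x y {w} : w ||- czero o -> w ||- (iter o f x y <-> x == y).
Proof.
  intros Ho. split; fintro H.
  - fdes H as t [H1 [H2 H3]]. apply (oiff_elim1 (pin_zero f t Ho)) in H2.
    exact (oiff_elim1 (pin_id x y H2) H3).
  - fdes (id_ex w) as i Hi. fexists i. fsplit.
    + exact (FUNC_id Hi).
    + exact (oiff_elim2 (pin_zero f i Ho) Hi).
    + exact (oiff_elim2 (pin_id x y Hi) H).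
Qed.

Lemma iter_sval {n m f} x y {w} : w ||- FUNC n -> w ||- FUNC f -> w ||- sval n m ->
  w ||- (iter m f x y <-> ex q, (iter n f x q /\ pin q y f)).
Proof.
  intros Hn Hf Hm. split; fintro H.
  - fdes H as p [H1 [H2 H3]].
    apply (oiff_elim1 (pin_sval f p Hm)) in H2. destruct H2 as [_ H2].
    apply (oiff_elim1 (pin_comp x y H2)) in H3.
    fdes H3 as t Ht. fdes Ht as q [K1 [K2 [K3 K4]]].
    fexists q. split; [|exact K4]. fexists t. now fsplit.
  - fdes H as q [Hq K4]. fdes Hq as t [K1 [K2 K3]].
    fdes (comp_ex n f w) as p Hp. fexists p. fsplit.
    + exact (FUNC_comp Hn Hf Hp).
    + apply (oiff_elim2 (pin_sval f p Hm)). now split.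
    + apply (oiff_elim2 (pin_comp x y Hp)). fexists t. fexists q. now fsplit.
Qed.

(** The stratified half of counting. [FUNC q] is carried along because [S] has a value at [q] only
    then. *)
Lemma iter_succ_zero_ex {n s o w} : w ||- inN n -> w ||- csucc s -> w ||- czero o ->
  w ||- (ex q, (FUNC q /\ iter n s o q)).
Proof.
  intros Hn Hs Ho.
  apply (N_ind (P := fun n => (ex q, (FUNC q /\ iter n s o q))%om)); auto.
  - refine (comprehension (p := (ex q, in_FUNC q /\ h_iter 2 0 1 q)%hf 3)
      (e := o .: s .: env0) _). strat.
  - intros o'. fintro Ho'. fexists o. split; [exact (FUNC_zero Ho)|].
    exact (oiff_elim2 (iter_zero s o o Ho') (oeq_refl o w)).
  - intros x y. fintro Hx. fintro H. fintro Hy. fdes H as q [H1 H2].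
    fdes (sval_ex q w) as r Hr. fexists r. split; [exact (FUNC_sval Hr)|].
    apply (oiff_elim2 (iter_sval o r (N_FUNC Hx) (FUNC_succ Hs) Hy)).
    fexists q. split; [exact H2|].
    apply (oiff_elim2 (pin_succ q r Hs)). now split.
Qed.

(** The axiom concerns [Ap], which does not tell a value from an undefined application; once a value
    is known to exist, [Ap] must equal it. *)
Lemma iter_succ_zero {n s o w} : w ||- inN n -> w ||- csucc s -> w ||- czero o ->
  w ||- iter n s o n.
Proof.
  intros Hn Hs Ho. fdes (iter_succ_zero_ex Hn Hs Ho) as q [_ H].
  fdes (counting Hn) as s' Ks. fdes Ks as o' Ko. fdes Ko as js [K1 [K2 [K3 K4]]].
  assert (E := succ_unique K1 Hs). fsubst E.
  assert (E := zero_unique K2 Ho). fsubst E.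
  assert (H' := H). fdes H' as t [H1 [H2 H3]].
  assert (E := Ap_unique K3 (Ap_pin (N_FUNC Hn) H2)). fsubst E.
  assert (R : respectful (iter n s o)) by resp.
  exact (R w q n (oeq_sym (Ap_unique K4 (Ap_pin H1 H3))) H).
Qed.

(* [g] extends the successor by [a |-> 0] for some [a] outside [FUNC], so
   [(n + 1) g a = n S 0]. *)
Lemma iter_detour {n m s o a g w} :
  w ||- csucc s -> w ||- czero o -> w ||- (~ FUNC a) ->
  w ||- FUNC g -> w ||- (all x y, (pin x y g <-> pin x y s \/ x == a /\ y == o)) ->
  w ||- inN n -> w ||- sval n m -> w ||- (all x, (iter n s o x <-> iter m g a x)).
Proof.
  intros Hs Ho Ha Hg G Hn Hm.
  (* The successor [m] changes with [n], so it is quantified inside the induction formula. *)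
  assert (K : w ||- (all m, (sval n m -> (all x, (iter n s o x <-> iter m g a x)))));
    [clear m Hm|exact (oimp_elim (K m) Hm)].
  refine (N_ind (P := fun n =>
    (all m, (sval n m -> (all x, (iter n s o x <-> iter m g a x))))%om) _ _ _ Hn).
  - refine (comprehension (p := (all m, is_church_succ_value 4 m ->
      all x, h_iter 4 0 1 x <-> h_iter m 3 2 x)%hf 5)
      (e := g .: a .: o .: s .: env0) _). strat.
  - intros o'. fintro Ho'. intros m. fintro Hm. intros x. split; fintro H.
    + apply (oiff_elim2 (iter_sval a x (FUNC_zero Ho') Hg Hm)).
      fexists a. fsplit.
      * exact (oiff_elim2 (iter_zero g a a Ho') (oeq_refl a w)).
      * apply (oiff_elim2 (G a x)), oor_intro2. split; [apply oeq_refl|].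
        exact (oeq_sym (oiff_elim1 (iter_zero s o x Ho') H)).
    + apply (oiff_elim1 (iter_sval a x (FUNC_zero Ho') Hg Hm)) in H.
      fdes H as q [H1 H2]. apply (oiff_elim1 (iter_zero g a q Ho')) in H1.
      apply oeq_sym in H1. fsubst H1. fcase (oiff_elim1 (G a x) H2) as K.
      * apply obot_elim, (oimp_elim Ha).
        exact (proj1 (oiff_elim1 (pin_succ a x Hs) K)).
      * apply (oiff_elim2 (iter_zero s o x Ho')). exact (oeq_sym (proj2 K)).
  - intros x y. fintro Hx. fintro IH. fintro Hy. intros m. fintro Hm. intros z.
    assert (Hg' := oimp_elim (IH y) Hy).
    assert (Fs := FUNC_succ Hs). assert (Fx := N_FUNC Hx). assert (Fy := FUNC_sval Hy).
    split; fintro H.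
    + apply (oiff_elim1 (iter_sval o z Fx Fs Hy)) in H. fdes H as q [H1 H2].
      apply (oiff_elim2 (iter_sval a z Fy Hg Hm)). fexists q. split.
      * exact (oiff_elim1 (Hg' q) H1).
      * exact (oiff_elim2 (G q z) (oor_intro1 _ H2)).
    + apply (oiff_elim1 (iter_sval a z Fy Hg Hm)) in H. fdes H as q [H1 H2].
      apply (oiff_elim2 (Hg' q)) in H1.
      apply (oiff_elim2 (iter_sval o z Fx Fs Hy)). fexists q. split; [exact H1|].
      fcase (oiff_elim1 (G q z) H2) as K; [exact K|].
      (* The extra pair of [g] would be used only if [q = a]; but [q] is [x S 0], which counting
         says is [x], a function. *)
      apply obot_elim, (oimp_elim Ha). frwg (proj1 K).
      frwg (iter_unique Fx (iter_succ_zero Hx Hs Ho) H1). exact Fx.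
Qed.

(** The added pair cannot clash with [S], which has no value at a non-function. The case
    distinctions come from the disjunction that defines [g], so [x = a] need not be decidable. *)
Lemma detour_ex {s o a w} : w ||- csucc s -> w ||- (~ FUNC a) ->
  w ||- (ex g, (FUNC g /\ all x y, (pin x y g <-> pin x y s \/ x == a /\ y == o))).
Proof.
  intros Hs Ha.
  assert (C : w ||- (ex g, all u, (u in_ g <-> ex x y,
    (pair x y u /\ (pin x y s \/ x == a /\ y == o))))).
  { refine (comprehension (p := (ex x y, is_pair x y 3 /\
      (pair_in x y 2 \/ x == 1 /\ y == 0))%hf 4) (e := s .: a .: o .: env0) _). strat. }
  fdes C as g Hg. fexists g.
  assert (G : w ||- (all x y, (pin x y g <-> pin x y s \/ x == a /\ y == o))).
  { intros x y.
    apply (pin_relation (P := fun x y => (pin x y s \/ x == a /\ y == o)%om));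
      intros; auto; resp. }
  split; [|exact G].
  assert (Hd : w ||- (all y, ~ pin a y s)).
  { intros y. fintro K. apply (oimp_elim Ha).
    exact (proj1 (oiff_elim1 (pin_succ a y Hs) K)). }
  intros x y z. fintro H. fintro K.
  fcase (oiff_elim1 (G x y) H) as H'; fcase (oiff_elim1 (G x z) K) as K'.
  - exact (FUNC_pin (FUNC_succ Hs) H' K').
  - apply obot_elim, (oimp_elim (Hd y)). destruct K' as [E _]. frw E H'. exact H'.
  - apply obot_elim, (oimp_elim (Hd z)). destruct H' as [E _]. frw E K'. exact K'.
  - exact (oeq_trans (proj2 H') (oeq_sym (proj2 K'))).
Qed.

Lemma sval_inj {n n' m w} : w ||- inN n -> w ||- inN n' ->
  w ||- sval n m -> w ||- sval n' m -> w ||- n == n'.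
Proof.
  intros Hn Hn' Hm Hm'. fdes (succ_ex w) as s Hs. fdes (zero_ex w) as o Ho.
  fdes (not_FUNC_ex w) as a Ha. fdes (detour_ex (o := o) Hs Ha) as g [Hg G].
  assert (H := oiff_elim1 (iter_detour Hs Ho Ha Hg G Hn Hm n)
    (iter_succ_zero Hn Hs Ho)).
  (* The same [m g a] is both [n S 0] and [n' S 0], because [m] is the successor of both. *)
  assert (H' := oiff_elim2 (iter_detour Hs Ho Ha Hg G Hn' Hm' n) H).
  exact (iter_unique (N_FUNC Hn') H' (iter_succ_zero Hn' Hs Ho)).
Qed.

(** * Addition and multiplication *)

(** Primitive recursion with start [a] and step [G], the latter given as a set of pairs. [a], [y]
    and [z] share one type, three below that of [R] and [G]. *)
Definition rec a G y z : Om :=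
  (all R, ((all o, (czero o -> pin o a R)) ->
     (all u v u' v', (pin u v R -> sval u u' -> pin v v' G -> pin u' v' R)) ->
     pin y z R))%om.
Definition h_rec a G y z : hform :=
  (all R, (all o, is_church_zero o -> pair_in o a R) ->
     (all u v u' v', pair_in u v R -> is_church_succ_value u u' ->
        pair_in v v' G -> pair_in u' v' R) ->
     pair_in y z R)%hf.

Lemma rec_elim {R a G y z w} : w ||- rec a G y z ->
  w ||- (all o, (czero o -> pin o a R)) ->
  w ||- (all u v u' v', (pin u v R -> sval u u' -> pin v v' G -> pin u' v' R)) ->
  w ||- pin y z R.
Proof. intros H HO HS. exact (oimp_elim (oimp_elim (H R) HO) HS). Qed.

Lemma rec_base {o} a G {w} : w ||- czero o -> w ||- rec a G o a.
Proof. intros Ho R. fintro HO. fintro HS. exact (oimp_elim (HO o) Ho). Qed.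

Lemma rec_step {a G y z y' z' w} : w ||- rec a G y z -> w ||- sval y y' ->
  w ||- pin z z' G -> w ||- rec a G y' z'.
Proof.
  intros H Hy Hz R. fintro HO. fintro HS.
  exact (oimp_elim (oimp_elim (oimp_elim (HS y z y' z') (rec_elim H HO HS)) Hy) Hz).
Qed.

(** The test relation demands [y = a] only when [x] is zero; the step condition is then vacuous, as
    a successor is never zero. *)
Lemma rec_zero {o a G z w} : w ||- czero o -> w ||- rec a G o z -> w ||- z == a.
Proof.
  intros Ho H.
  assert (C : w ||- (ex R, all u, (u in_ R <-> ex x y,
    (pair x y u /\ (czero x -> y == a))))).
  { refine (comprehension (p := (ex x y, is_pair x y 1 /\
      (is_church_zero x -> y == 0))%hf 2) (e := a .: env0) _). strat. }
  fdes C as R HR.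
  assert (K : w ||- (all x y, (pin x y R <-> (czero x -> y == a)))).
  { intros x y. apply (pin_relation (P := fun x y => (czero x -> y == a)%om));
      intros; [resp|resp|exact HR]. }
  refine (oimp_elim (oiff_elim1 (K o z) (rec_elim H _ _)) Ho).
  - intros x. fintro Hx. apply (oiff_elim2 (K x a)). fintro Hx'. apply oeq_refl.
  - intros u v u' v'. fintro H1. fintro H2. fintro H3.
    apply (oiff_elim2 (K u' v')). fintro H4. apply obot_elim.
    exact (zero_not_sval H4 H2).
Qed.

Lemma rec_succ {a G y y' z w} : w ||- inN y -> w ||- sval y y' ->
  w ||- rec a G y' z -> w ||- (ex v, (rec a G y v /\ pin v z G)).
Proof.
  intros Hy Hy' H.
  (* The test relation also keeps [inN u], so that injectivity applies to the predecessor [u], and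
     [rec a G u v], which provides the value at [y] once [u = y] is known. *)
  set (P := fun u v => (inN u /\ rec a G u v /\
    (sval y u -> ex x, (rec a G y x /\ pin x v G)))%om).
  assert (C : w ||- (ex R, all u, (u in_ R <-> ex x y, (pair x y u /\ P x y)))).
  { refine (comprehension (p := (ex u v, is_pair u v 3 /\ in_N u /\ h_rec 0 1 u v /\
      (is_church_succ_value 2 u -> ex x, h_rec 0 1 2 x /\ pair_in x v 1))%hf 4)
      (e := y .: G .: a .: env0) _). strat. }
  fdes C as R HR.
  assert (K : w ||- (all x y, (pin x y R <-> P x y))).
  { intros u v. apply (pin_relation (P := P));
      intros; unfold P; [resp|resp|exact HR]. }
  refine (oimp_elim (proj2 (proj2 (oiff_elim1 (K y' z) (rec_elim H _ _)))) Hy').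
  - intros o. fintro Ho. apply (oiff_elim2 (K o a)). unfold P. fsplit.
    + exact (N_zero Ho).
    + exact (rec_base a G Ho).
    + fintro Ho'. apply obot_elim. exact (zero_not_sval Ho Ho').
  - intros u v u' v'. fintro H1. fintro H2. fintro H3.
    apply (oiff_elim2 (K u' v')). apply (oiff_elim1 (K u v)) in H1.
    destruct H1 as [Hu [Hv _]]. unfold P. fsplit.
    + exact (N_succ Hu H2).
    + exact (rec_step Hv H2 H3).
    + fintro H4. fexists v. split; [|exact H3].
      frwg (sval_inj Hu Hy H2 H4). exact Hv.
Qed.

Lemma rec_total {a G y w} :
  w ||- (all v, (inN v -> ex v', (inN v' /\ pin v v' G))) ->
  w ||- inN a -> w ||- inN y -> w ||- (ex z, (inN z /\ rec a G y z)).
Proof.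
  intros HG Ha Hy.
  refine (N_ind (P := fun y => (ex z, (inN z /\ rec a G y z))%om) _ _ _ Hy).
  - refine (comprehension (p := (ex z, in_N z /\ h_rec 0 1 2 z)%hf 3)
      (e := G .: a .: env0) _). strat.
  - intros o. fintro Ho. fexists a. split; [exact Ha|exact (rec_base a G Ho)].
  - intros u u'. fintro Hu. fintro H. fintro Hu'. fdes H as v [H1 H2].
    fdes (oimp_elim (HG v) H1) as v' [H3 H4]. fexists v'.
    split; [exact H3|exact (rec_step H2 Hu' H4)].
Qed.

(** Induction on [y]: both values are inverted by [rec_zero] or [rec_succ], and the
    single-valuedness of [G] passes equality on. *)
Lemma rec_unique {a G y z z' w} : w ||- FUNC G -> w ||- inN y ->
  w ||- rec a G y z -> w ||- rec a G y z' -> w ||- z == z'.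
Proof.
  intros HG Hy H H'.
  assert (K : w ||- (all z z', (rec a G y z -> rec a G y z' -> z == z')));
    [clear z z' H H'|exact (oimp_elim (oimp_elim (K z z') H) H')].
  refine (N_ind (P := fun y =>
    (all z z', (rec a G y z -> rec a G y z' -> z == z'))%om) _ _ _ Hy).
  - refine (comprehension (p := (all z z', h_rec 0 1 2 z -> h_rec 0 1 2 z' -> z == z')%hf 3)
      (e := G .: a .: env0) _). strat.
  - intros o. fintro Ho. intros z z'. fintro H. fintro H'.
    exact (oeq_trans (rec_zero Ho H) (oeq_sym (rec_zero Ho H'))).
  - intros u u'. fintro Hu. fintro IH. fintro Hu'. intros z z'. fintro H. fintro H'.
    fdes (rec_succ Hu Hu' H) as v [H1 H2].
    fdes (rec_succ Hu Hu' H') as v' [H1' H2'].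
    assert (E := oimp_elim (oimp_elim (IH v v') H1) H1'). frw E H2.
    exact (FUNC_pin HG H2 H2').
Qed.

Definition add x y z : Om := (ex s, (csucc s /\ rec x s y z))%om.
Definition h_add x y z : hform := (ex s, is_church_succ s /\ h_rec x s y z)%hf.

Lemma add_zero {o} x {w} : w ||- czero o -> w ||- add x o x.
Proof.
  intros Ho. fdes (succ_ex w) as s Hs. fexists s.
  split; [exact Hs|exact (rec_base x s Ho)].
Qed.

Lemma add_succ {x y z y' z' w} : w ||- FUNC z -> w ||- sval y y' -> w ||- sval z z' ->
  w ||- add x y z -> w ||- add x y' z'.
Proof.
  intros Fz Hy Hz H. fdes H as s [Hs K]. fexists s. split; [exact Hs|].
  apply (rec_step K Hy). apply (oiff_elim2 (pin_succ z z' Hs)). now split.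
Qed.

Lemma add_total {x y w} : w ||- inN x -> w ||- inN y ->
  w ||- (ex z, (inN z /\ add x y z)).
Proof.
  intros Hx Hy. fdes (succ_ex w) as s Hs.
  assert (HG : w ||- (all v, (inN v -> ex v', (inN v' /\ pin v v' s)))).
  { intros v. fintro Hv. fdes (sval_ex v w) as v' Hv'. fexists v'.
    split; [exact (N_succ Hv Hv')|].
    apply (oiff_elim2 (pin_succ v v' Hs)). split; [exact (N_FUNC Hv)|exact Hv']. }
  fdes (rec_total HG Hx Hy) as z [H1 H2]. fexists z. split; [exact H1|].
  fexists s. now split.
Qed.

Lemma add_unique {x y z z' w} : w ||- inN y -> w ||- add x y z -> w ||- add x y z' ->
  w ||- z == z'.
Proof.
  intros Hy H H'. fdes H as s [Hs K]. fdes H' as s' [Hs' K'].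
  assert (E := succ_unique Hs' Hs). frw E K'.
  exact (rec_unique (FUNC_succ Hs) Hy K K').
Qed.

(** The map [v |-> v + x] as a set; it is the step in [x * (y + 1) = x * y + x]. *)
Definition adder x G : Om :=
  (all u, (u in_ G <-> ex v v', (pair v v' u /\ add v x v')))%om.
Definition h_adder x G : hform :=
  (all u, u in_ G <-> ex v v', is_pair v v' u /\ h_add v x v')%hf.

Lemma adder_ex x w : w ||- (ex G, adder x G).
Proof.
  refine (comprehension (p := (ex v v', is_pair v v' 1 /\ h_add v 0 v')%hf 2)
    (e := x .: env0) _). strat.
Qed.

Lemma pin_adder {x G} v v' {w} : w ||- adder x G -> w ||- (pin v v' G <-> add v x v').
Proof.
  intros HG. apply (pin_relation (P := fun v v' => add v x v'));
    intros; [resp|resp|exact HG].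
Qed.

Lemma FUNC_adder {x G w} : w ||- inN x -> w ||- adder x G -> w ||- FUNC G.
Proof.
  intros Hx HG v y z. fintro H. fintro K.
  apply (oiff_elim1 (pin_adder _ _ HG)) in H, K. exact (add_unique Hx H K).
Qed.

Definition mul x y z : Om := (ex G o, (adder x G /\ czero o /\ rec o G y z))%om.
Definition h_mul x y z : hform :=
  (ex G o, h_adder x G /\ is_church_zero o /\ h_rec o G y z)%hf.

Lemma mul_zero {o} x {w} : w ||- czero o -> w ||- mul x o o.
Proof.
  intros Ho. fdes (adder_ex x w) as G HG. fexists G. fexists o.
  fsplit; [exact HG|exact Ho|exact (rec_base o G Ho)].
Qed.

Lemma mul_succ {x y z y' z' w} : w ||- sval y y' -> w ||- add z x z' ->
  w ||- mul x y z -> w ||- mul x y' z'.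
Proof.
  intros Hy Hz H. fdes H as G H1. fdes H1 as o [HG [Ho H2]].
  fexists G. fexists o. fsplit; [exact HG|exact Ho|].
  exact (rec_step H2 Hy (oiff_elim2 (pin_adder z z' HG) Hz)).
Qed.

Lemma mul_total {x y w} : w ||- inN x -> w ||- inN y ->
  w ||- (ex z, (inN z /\ mul x y z)).
Proof.
  intros Hx Hy. fdes (adder_ex x w) as G H. fdes (zero_ex w) as o Ho.
  assert (HG : w ||- (all v, (inN v -> ex v', (inN v' /\ pin v v' G)))).
  { intros v. fintro Hv. fdes (add_total Hv Hx) as v' [H1 H2]. fexists v'.
    split; [exact H1|exact (oiff_elim2 (pin_adder v v' H) H2)]. }
  fdes (rec_total HG (N_zero Ho) Hy) as z [H1 H2]. fexists z. split; [exact H1|].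
  fexists G. fexists o. now fsplit.
Qed.

Lemma mul_unique {x y z z' w} : w ||- inN x -> w ||- inN y ->
  w ||- mul x y z -> w ||- mul x y z' -> w ||- z == z'.
Proof.
  intros Hx Hy H H'. fdes H as G H1. fdes H1 as o [HG [Ho H2]].
  fdes H' as G' H1'. fdes H1' as o' [HG' [Ho' H2']].
  assert (E : w ||- G' == G) by exact (def_unique HG' HG). frw E H2'.
  assert (E' := zero_unique Ho' Ho). frw E' H2'.
  exact (rec_unique (FUNC_adder Hx HG) Hy H2 H2').
Qed.

(** * Soundness of the translation *)

(** Graphs list their arguments from index [0], whereas names count from the outermost binder, so
    the names run downwards. On [N], whose elements are functions, [is_church_succ_value] is the
    graph of [S]. *)
Definition church : interpretation := {|
  dom := in_N 0 1;
  zero_graph := is_church_zero 0 1;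
  succ_graph := is_church_succ_value 1 0 2;
  add_graph := h_add 2 1 0 3;
  mul_graph := h_mul 2 1 0 3
|}.

(** * Stratification of translated formulas *)

Lemma stratified_by_ext (p : sform) : forall e e', (forall n, e n = e' n) ->
  stratified_by e p -> stratified_by e' p.
Proof.
  induction p; cbn; intros e e' H; rewrite <- ?H; intuition eauto.
  - destruct H0 as [k Hk]. exists k. revert Hk. apply IHp. intros [|n]; auto.
  - destruct H0 as [k Hk]. exists k. revert Hk. apply IHp. intros [|n]; auto.
Qed.

Lemma stratified_by_rename (p : sform) : forall s e,
  stratified_by (fun n => e (s n)) p -> stratified_by e (rename s p).
Proof.
  induction p; cbn; intros s' e; intuition eauto.
  - destruct H as [k Hk]. exists k. apply IHp. revert Hk.
    apply stratified_by_ext. now intros [|n].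
  - destruct H as [k Hk]. exists k. apply IHp. revert Hk.
    apply stratified_by_ext. now intros [|n].
Qed.

(* Any type that leaves room below for the components of a Church number. *)
Definition church_type : nat -> nat := fun _ => 20.

Lemma church_type_ex (p : sform) : stratified_by church_type p ->
  exists k, stratified_by (fun n => match n with 0 => k | S m => church_type m end) p.
Proof.
  intros H. exists 20. revert H. apply stratified_by_ext. now intros [|n].
Qed.

Lemma dom_church_stratified xs : stratified_by church_type (at_vars (dom church) xs).
Proof.
  apply stratified_by_rename. unshelve (cbv; strat_goals); exact 0.
Qed.

Lemma denotes_stratified t : forall e y,
  stratified_by church_type (denotes church e t y).
Proof.
  induction t; intros e y; cbn [denotes].
  - reflexivity.
  - apply stratified_by_rename. unshelve (cbv; strat_goals); exact 0.
  - apply church_type_ex. split; [apply dom_church_stratified|].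
    split; [apply IHt|].
    apply stratified_by_rename. unshelve (cbv; strat_goals); exact 0.
  - apply church_type_ex. split; [apply dom_church_stratified|].
    apply church_type_ex. split; [apply dom_church_stratified|].
    split; [apply IHt1|]. split; [apply IHt2|].
    apply stratified_by_rename. unshelve (cbv; strat_goals); exact 0.
  - apply church_type_ex. split; [apply dom_church_stratified|].
    apply church_type_ex. split; [apply dom_church_stratified|].
    split; [apply IHt1|]. split; [apply IHt2|].
    apply stratified_by_rename. unshelve (cbv; strat_goals); exact 0.
Qed.

Lemma translate_stratified (p : form ha_lang) : stratified (translate church p).
Proof.
  exists church_type. induction p; cbn [translate].
  - exact I.
  - apply church_type_ex. split; [apply dom_church_stratified|].
    split; apply denotes_stratified.
  - destruct r.
  - now split.
  - now split.
  - now split.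
  - apply church_type_ex. split; [apply dom_church_stratified|exact IHp].
  - apply church_type_ex. split; [apply dom_church_stratified|exact IHp].
Qed.

(** [denotes] without its index shifts: [r] sends each variable of arithmetic directly to a name in
    set theory. *)
Fixpoint den (r : nat -> nat) (t : ha_term) (y : nat) : Om :=
  match t with
  | HVar n => (r n == y)%om
  | HZero => czero y
  | HSucc t => (ex v, (inN v /\ den r t v /\ sval v y))%om
  | HAdd t u =>
      (ex a, (inN a /\ ex b, (inN b /\ den r t a /\ den r u b /\ add a b y)))%om
  | HMul t u =>
      (ex a, (inN a /\ ex b, (inN b /\ den r t a /\ den r u b /\ mul a b y)))%om
  end.

Lemma sem_denotes t : forall e r y w,
  w ||- sem r (denotes church e t y) <-> w ||- den (fun n => r (e n)) t (r y).
Proof.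
  induction t; intros e r y w; cbn [denotes den].
  - reflexivity.
  - reflexivity.
  - split; intros H; fdes H as v [H1 [H2 H3]]; fexists v;
      (split; [exact H1|split; [|exact H3]]);
      apply (IHt (fun n => 1 + e n) (v .: r) 0); exact H2.
  - split; intros H; fdes H as a [H1 H2]; fdes H2 as b [H3 [H4 [H5 H6]]];
      fexists a; (split; [exact H1|]); fexists b; (split; [exact H3|]);
      (split; [|split; [|exact H6]]).
    + apply (IHt1 (fun n => 2 + e n) (b .: a .: r) 1); exact H4.
    + apply (IHt2 (fun n => 2 + e n) (b .: a .: r) 0); exact H5.
    + apply (IHt1 (fun n => 2 + e n) (b .: a .: r) 1); exact H4.
    + apply (IHt2 (fun n => 2 + e n) (b .: a .: r) 0); exact H5.
  - split; intros H; fdes H as a [H1 H2]; fdes H2 as b [H3 [H4 [H5 H6]]];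
      fexists a; (split; [exact H1|]); fexists b; (split; [exact H3|]);
      (split; [|split; [|exact H6]]).
    + apply (IHt1 (fun n => 2 + e n) (b .: a .: r) 1); exact H4.
    + apply (IHt2 (fun n => 2 + e n) (b .: a .: r) 0); exact H5.
    + apply (IHt1 (fun n => 2 + e n) (b .: a .: r) 1); exact H4.
    + apply (IHt2 (fun n => 2 + e n) (b .: a .: r) 0); exact H5.
Qed.

(** A forced proposition rather than a family of them, so that it passes to larger worlds as a
    whole. *)
Notation nat_env r := (oall (fun n => inN (r n))).

Lemma nat_env_cons {x r w} : w ||- inN x -> w ||- nat_env r -> w ||- nat_env (x .: r).
Proof. intros Hx Hr [|n]; [exact Hx|exact (Hr n)]. Qed.

Lemma den_respectful r t : respectful (den r t).
Proof. destruct t; cbn [den]; resp. Qed.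

Lemma den_total t {r w} : w ||- nat_env r -> w ||- (ex y, (inN y /\ den r t y)).
Proof.
  revert w. induction t; intros w Hr; cbn [den].
  - fexists (r n). split; [exact (Hr n)|apply oeq_refl].
  - fdes (zero_ex w) as o Ho. fexists o. split; [exact (N_zero Ho)|exact Ho].
  - fdes (IHt w Hr) as v [H1 H2]. fdes (sval_ex v w) as y Hy. fexists y.
    split; [exact (N_succ H1 Hy)|]. fexists v. now fsplit.
  - fdes (IHt1 w Hr) as a [H1 H2]. fdes (IHt2 w Hr) as b [H3 H4].
    fdes (add_total H1 H3) as y [H5 H6]. fexists y. split; [exact H5|].
    fexists a. split; [exact H1|]. fexists b. now fsplit.
  - fdes (IHt1 w Hr) as a [H1 H2]. fdes (IHt2 w Hr) as b [H3 H4].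
    fdes (mul_total H1 H3) as y [H5 H6]. fexists y. split; [exact H5|].
    fexists a. split; [exact H1|]. fexists b. now fsplit.
Qed.

(** [r] may leave [N]: the numbers required by [add_unique] and [mul_unique] are the relativized
    witnesses for the subterms. *)
Lemma den_unique t {r y y' w} : w ||- den r t y -> w ||- den r t y' -> w ||- y == y'.
Proof.
  revert y y' w. induction t; intros y y' w H H'; cbn [den] in H, H'.
  - exact (oeq_trans (oeq_sym H) H').
  - exact (zero_unique H H').
  - fdes H as v [H1 [H2 H3]]. fdes H' as v' [K1 [K2 K3]].
    assert (E := IHt _ _ _ H2 K2). frw E H3. exact (sval_unique H3 K3).
  - fdes H as a H0. destruct H0 as [H1 H2]. fdes H2 as b [H3 [H4 [H5 H6]]].
    fdes H' as a' K0. destruct K0 as [K1 K2]. fdes K2 as b' [K3 [K4 [K5 K6]]].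
    assert (E := IHt1 _ _ _ H4 K4). assert (E' := IHt2 _ _ _ H5 K5).
    frw E H6. frw E' H6. exact (add_unique K3 H6 K6).
  - fdes H as a H0. destruct H0 as [H1 H2]. fdes H2 as b [H3 [H4 [H5 H6]]].
    fdes H' as a' K0. destruct K0 as [K1 K2]. fdes K2 as b' [K3 [K4 [K5 K6]]].
    assert (E := IHt1 _ _ _ H4 K4). assert (E' := IHt2 _ _ _ H5 K5).
    frw E H6. frw E' H6. exact (mul_unique K1 K3 H6 K6).
Qed.

(** Only the variable case is not structural: uniqueness of values turns a denotation of [s n] into
    an equality with [r' n]. *)
Lemma den_subst t : forall s r r' y w, w ||- (all n, den r (s n) (r' n)) ->
  (w ||- den r (ha_subst s t) y <-> w ||- den r' t y).
Proof.
  induction t; intros s r r' y w Hs; cbn [den ha_subst].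
  - split; intros H.
    + exact (den_unique (s n) (Hs n) H).
    + exact (den_respectful r (s n) w _ _ H (Hs n)).
  - reflexivity.
  - split; intros H; fdes H as v [H1 [H2 H3]]; fexists v;
      (split; [exact H1|split; [|exact H3]]); apply (IHt _ _ _ _ _ Hs), H2.
  - split; intros H; fdes H as a [H1 H2]; fdes H2 as b [H3 [H4 [H5 H6]]];
      fexists a; (split; [exact H1|]); fexists b; (split; [exact H3|]);
      (split; [apply (IHt1 _ _ _ _ _ Hs), H4|
       split; [apply (IHt2 _ _ _ _ _ Hs), H5|exact H6]]).
  - split; intros H; fdes H as a [H1 H2]; fdes H2 as b [H3 [H4 [H5 H6]]];
      fexists a; (split; [exact H1|]); fexists b; (split; [exact H3|]);
      (split; [apply (IHt1 _ _ _ _ _ Hs), H4|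
       split; [apply (IHt2 _ _ _ _ _ Hs), H5|exact H6]]).
Qed.

(** * Translated formulas and the soundness of arithmetic *)

Definition tr (r : nat -> nat) (p : form ha_lang) : Om := sem r (translate church p).

Lemma tr_eq r t u w : w ||- tr r (@Eq ha_lang t u) <->
  w ||- (ex y, (inN y /\ den r t y /\ den r u y)).
Proof.
  split; intros H; fdes H as y [H1 [H2 H3]]; fexists y; (split; [exact H1|]);
    split; apply (sem_denotes _ (fun n => 1 + n) (y .: r) 0); assumption.
Qed.

Lemma den_up {s r r' x w} : w ||- (all n, den r (s n) (r' n)) ->
  w ||- (all n, den (x .: r) (@up ha_lang s n) ((x .: r') n)).
Proof.
  intros Hs [|n].
  - exact (oeq_refl x w).
  - apply (den_subst (s n) (fun k => HVar (S k)) (x .: r) r (r' n) w).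
    + intros k. exact (oeq_refl (r k) w).
    + exact (Hs n).
Qed.

Lemma tr_subst p : forall (s : nat -> ha_term) r r' w, w ||- (all n, den r (s n) (r' n)) ->
  (w ||- tr r (@subst ha_lang s p) <-> w ||- tr r' p).
Proof.
  induction p; intros s' r0 r' w Hs.
  - reflexivity.
  - cbn [subst]. rewrite !tr_eq. split; intros H; fdes H as y [H1 [H2 H3]]; fexists y;
      (split; [exact H1|]); split; (apply (den_subst _ _ _ _ _ _ Hs); assumption).
  - destruct r.
  - split; intros [H1 H2]; (split; [apply (IHp1 _ _ _ _ Hs), H1
      |apply (IHp2 _ _ _ _ Hs), H2]).
  - split; intros H; fcase H as K;
      [apply oor_intro1|apply oor_intro2|apply oor_intro1|apply oor_intro2];
      first [apply (IHp1 _ _ _ _ Hs), K|apply (IHp2 _ _ _ _ Hs), K].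
  - split; intros H; fintro K.
    + apply (IHp2 _ _ _ _ Hs), (oimp_elim H), (IHp1 _ _ _ _ Hs), K.
    + apply (IHp2 _ _ _ _ Hs), (oimp_elim H), (IHp1 _ _ _ _ Hs), K.
  - split; intros H x; specialize (H x); fintro K; apply (IHp _ _ _ _ (den_up Hs));
      exact (oimp_elim H K).
  - split; intros H; fdes H as x [H1 H2]; fexists x; (split; [exact H1|]);
      apply (IHp _ _ _ _ (den_up Hs)), H2.
Qed.

Lemma tr_inst {t v p r w} : w ||- den r t v ->
  (w ||- tr r (@inst ha_lang t p) <-> w ||- tr (v .: r) p).
Proof.
  intros Hv. apply tr_subst. intros [|n]; [exact Hv|exact (oeq_refl (r n) w)].
Qed.

Lemma tr_shift {p v r w} : w ||- tr (v .: r) (@shift ha_lang p) <-> w ||- tr r p.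
Proof. apply tr_subst. intros n. exact (oeq_refl (r n) w). Qed.

Lemma induction_sound p {r w} : w ||- nat_env r ->
  w ||- tr r (Imp (@inst ha_lang HZero p)
       (Imp (All (Imp p (@subst ha_lang
                    (fun n => match n with
                              | 0 => HSucc (HVar 0)
                              | S m => HVar (S m)
                              end) p)))
            (All p))).
Proof.
  intros Hr. fintro H0. fintro HS. intros x. fintro Hx.
  refine (N_ind (P := fun x => tr (x .: r) p) _ _ _ Hx).
  - exact (comprehension (p := translate church p) (e := r) (translate_stratified p)).
  - intros o. fintro Ho. exact (proj1 (tr_inst (t := HZero) Ho) H0).
  - intros u v. fintro Hu. fintro H. fintro Hv.
    (* Under [u .: r] the substituted term [HSucc (HVar 0)] denotes [v], so the substituted formula
       says that [p] holds at [v]. *)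
    refine (proj1 (tr_subst p _ (u .: r) (v .: r) w _)
      (oimp_elim (oimp_elim (HS u) Hu) H)).
    intros [|n].
    + fexists u. split; [exact Hu|split; [apply oeq_refl|exact Hv]].
    + exact (oeq_refl (r n) w).
Qed.

Lemma axiom_sound p : HA p -> forall r w, w ||- nat_env r -> w ||- tr r p.
Proof.
  intros H r w Hr. destruct H.
  - fintro H. apply (proj1 (tr_eq _ _ _ _)) in H. fdes H as y [H1 [H2 H3]].
    fdes H2 as x [H4 [H5 H6]]. exact (zero_not_sval H3 H6).
  - fintro H. apply (proj1 (tr_eq _ _ _ _)) in H. fdes H as y [H1 [H2 H3]].
    fdes H2 as a [H4 [H5 H6]]. fdes H3 as b [H7 [H8 H9]].
    apply tr_eq. fexists a. split; [exact H4|]. split; [exact H5|].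
    exact (oeq_trans H8 (sval_inj H7 H4 H9 H6)).
  - apply tr_eq. fexists (r 0). split; [exact (Hr 0)|]. split; [|apply oeq_refl].
    fdes (zero_ex w) as o Ho. fexists (r 0). split; [exact (Hr 0)|].
    fexists o. fsplit; [exact (N_zero Ho)|apply oeq_refl|exact Ho|].
    exact (add_zero (r 0) Ho).
  - fdes (add_total (Hr 0) (Hr 1)) as z [Hz H].
    fdes (sval_ex z w) as z' Hz'. fdes (sval_ex (r 1) w) as y' Hy'.
    apply tr_eq. fexists z'. split; [exact (N_succ Hz Hz')|]. split.
    + fexists (r 0). split; [exact (Hr 0)|]. fexists y'.
      split; [exact (N_succ (Hr 1) Hy')|]. split; [apply oeq_refl|]. split.
      * fexists (r 1). split; [exact (Hr 1)|]. split; [apply oeq_refl|exact Hy'].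
      * exact (add_succ (N_FUNC Hz) Hy' Hz' H).
    + fexists z. split; [exact Hz|]. split; [|exact Hz'].
      fexists (r 0). split; [exact (Hr 0)|]. fexists (r 1).
      split; [exact (Hr 1)|]. split; [apply oeq_refl|].
      split; [apply oeq_refl|exact H].
  - fdes (zero_ex w) as o Ho. apply tr_eq. fexists o.
    split; [exact (N_zero Ho)|]. split; [|exact Ho].
    fexists (r 0). split; [exact (Hr 0)|].
    fexists o. split; [exact (N_zero Ho)|]. split; [apply oeq_refl|].
    split; [exact Ho|exact (mul_zero (r 0) Ho)].
  - fdes (mul_total (Hr 0) (Hr 1)) as z [Hz H].
    fdes (add_total Hz (Hr 0)) as z' [Nz Hz']. fdes (sval_ex (r 1) w) as y' Hy'.
    apply tr_eq. fexists z'. split; [exact Nz|]. split.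
    + fexists (r 0). split; [exact (Hr 0)|]. fexists y'.
      split; [exact (N_succ (Hr 1) Hy')|]. split; [apply oeq_refl|]. split.
      * fexists (r 1). split; [exact (Hr 1)|]. split; [apply oeq_refl|exact Hy'].
      * exact (mul_succ Hy' Hz' H).
    + fexists z. split; [exact Hz|]. fexists (r 0). split; [exact (Hr 0)|].
      split; [|split; [apply oeq_refl|exact Hz']].
      fexists (r 0). split; [exact (Hr 0)|]. fexists (r 1).
      split; [exact (Hr 1)|]. split; [apply oeq_refl|].
      split; [apply oeq_refl|exact H].
  - exact (induction_sound p Hr).
Qed.

(** Terms of arithmetic are not terms of set theory, so [AllE] and [ExI] instantiate at the value of
    the term, which [den_total] finds in [N]. *)
Lemma derives_sound G p : derives HA G p -> forall r w, w ||- nat_env r ->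
  (forall q, In q G -> w ||- tr r q) -> w ||- tr r p.
Proof.
  assert (up : forall w w' r (G : list (form ha_lang)), incl w w' ->
    (forall q, In q G -> w ||- tr r q) -> forall q, In q G -> w' ||- tr r q).
  { intros w w' r G' Hw HG q Hq. exact (force_mono Hw (HG q Hq)). }
  assert (ext : forall w w' r (q : form ha_lang) G, incl w w' ->
    (forall p, In p G -> w ||- tr r p) -> w' ||- tr r q ->
    forall p, In p (q :: G) -> w' ||- tr r p).
  { intros w w' r q G' Hw HG Hq p' [<-|Hp']; eauto. }
  assert (shf : forall w r x (G : list (form ha_lang)),
    (forall p, In p G -> w ||- tr r p) ->
    forall p, In p (map (@shift ha_lang) G) -> w ||- tr (x .: r) p).
  { intros w r x G' HG p' Hp'. apply in_map_iff in Hp'.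
    destruct Hp' as [q [<- Hq]]. apply tr_shift, HG, Hq. }
  induction 1; intros e w Hr HG.
  - now apply axiom_sound.
  - now apply HG.
  - exact (obot_elim (IHderives e w Hr HG)).
  - split; [exact (IHderives1 e w Hr HG)|exact (IHderives2 e w Hr HG)].
  - exact (proj1 (IHderives e w Hr HG)).
  - exact (proj2 (IHderives e w Hr HG)).
  - exact (oor_intro1 _ (IHderives e w Hr HG)).
  - exact (oor_intro2 _ (IHderives e w Hr HG)).
  - apply (oor_elim (IHderives1 e w Hr HG)); intros w' Hw K.
    + exact (IHderives2 e w' (force_mono Hw Hr) (ext _ _ _ _ _ Hw HG K)).
    + exact (IHderives3 e w' (force_mono Hw Hr) (ext _ _ _ _ _ Hw HG K)).
  - intros w' Hw K.
    exact (IHderives e w' (force_mono Hw Hr) (ext _ _ _ _ _ Hw HG K)).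
  - exact (oimp_elim (IHderives1 e w Hr HG) (IHderives2 e w Hr HG)).
  - intros x w' Hw Hx. apply IHderives.
    + exact (nat_env_cons Hx (force_mono Hw Hr)).
    + apply shf. exact (up _ _ _ _ Hw HG).
  - apply (oex_elim (den_total t Hr)). intros v w' Hw [Hv Ht].
    apply (tr_inst Ht). refine (oimp_elim _ Hv).
    exact (force_mono Hw (IHderives e w Hr HG) v).
  - apply (oex_elim (den_total t Hr)). intros v w' Hw [Hv Ht].
    fexists v. split; [exact Hv|]. apply (tr_inst Ht).
    exact (force_mono Hw (IHderives e w Hr HG)).
  - apply (oex_elim (IHderives1 e w Hr HG)). intros x w' Hw [Hx K].
    apply (tr_shift (v := x)). apply IHderives2.
    + exact (nat_env_cons Hx (force_mono Hw Hr)).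
    + intros p' [<-|Hp']; [exact K|]. revert p' Hp'. apply shf.
      exact (up _ _ _ _ Hw HG).
  - clear HG. apply tr_eq. fdes (den_total t Hr) as y [H1 H2]. fexists y. now fsplit.
  - assert (E := proj1 (tr_eq _ _ _ _) (IHderives1 e w Hr HG)).
    assert (K := IHderives2 e w Hr HG). clear HG.
    fdes E as y [H1 [H2 H3]]. apply (tr_inst H3). exact (proj1 (tr_inst H2) K).
Qed.

Lemma ha_subst_id t : forall n s, ha_scoped n t -> (forall m, m < n -> s m = HVar m) ->
  ha_subst s t = t.
Proof. induction t; cbn; intros k s H Hs; f_equal; intuition eauto. Qed.

Lemma ha_form_subst_id (p : form ha_lang) : forall n (s : nat -> ha_term), scoped n p ->
  (forall m, m < n -> s m = HVar m) -> @subst ha_lang s p = p.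
Proof.
  assert (up : forall n (s : nat -> ha_term), (forall m, m < n -> s m = HVar m) ->
    forall m, m < S n -> @up ha_lang s m = HVar m).
  { intros n s Hs [|m] Hm; [reflexivity|]. cbn. rewrite Hs by lia. reflexivity. }
  induction p; cbn; intros k s' H Hs.
  - reflexivity.
  - f_equal; eapply ha_subst_id; intuition eauto.
  - destruct r.
  - f_equal; intuition eauto.
  - f_equal; intuition eauto.
  - f_equal; intuition eauto.
  - f_equal. eauto.
  - f_equal. eauto.
Qed.

Theorem theorem19p21 : interpretable_in HA (extend INF church_counting).
Proof.
  exists church. split.
  1-5: cbv; lia.
  - apply sem_valid. intros w e. fdes (zero_ex w) as o Ho. fexists o. exact (N_zero Ho).
  - apply sem_valid. intros w e. fdes (zero_ex w) as o Ho. fexists o.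
    split; [split; [exact (N_zero Ho)|exact Ho]|].
    intros y. fintro _Hy. fintro K. exact (zero_unique K Ho).
  - apply sem_valid. intros w e x. fintro Hx. fdes (sval_ex x w) as y Hy. fexists y.
    split; [split; [exact (N_succ Hx Hy)|exact Hy]|].
    intros z. fintro Hz. fintro K. exact (sval_unique K Hy).
  - apply sem_valid. intros w e x. fintro Hx. intros y. fintro Hy.
    fdes (add_total Hx Hy) as z [Hz H]. fexists z. split; [split; [exact Hz|exact H]|].
    intros z'. fintro Hz'. fintro K. exact (add_unique Hy K H).
  - apply sem_valid. intros w e x. fintro Hx. intros y. fintro Hy.
    fdes (mul_total Hx Hy) as z [Hz H]. fexists z. split; [split; [exact Hz|exact H]|].
    intros z'. fintro Hz'. fintro K. exact (mul_unique Hx Hy K H).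
  - intros p Cp Hp. apply sem_valid. intros w e. change (w ||- tr e p).
    fdes (zero_ex w) as o Ho.
    (* The names [e n] need not be in [N]. As [p] is closed, substituting zero for all variables
       does not change it, and this trades [e] for the constant environment [o]. *)
    rewrite <- (ha_form_subst_id p 0 (fun _ => HZero) Cp) by (intros; lia).
    apply (tr_subst p _ e (fun _ => o)); [intros n; exact Ho|].
    apply (derives_sound [] p Hp); [intros n; exact (N_zero Ho)|intros q []].
Qed.
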